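(* Let $d\ge 3$ and let $V_d\subset L^2(\mathbb S^{d-1})$ be the $d$-dimensional irreducible $SO(d)$-module. Let $(v_{d/2},\dots,v_1,v_{-1},\dots,v_{-d/2})$ if $d$ is even (resp. $(v_{(d-1)/2},\dots,v_0,\dots,v_{-(d-1)/2})$ if $d$ is odd) be a self-conjugated orthonormal basis of $V_d$. Let $T$ be a real $SO(d)$-invariant random field on $\mathbb S^{d-1}$, and let $a_k=\int_{\mathbb S^{d-1}}T(x)\overline{v_k(x)}\,dx$ be its coefficients with respect to this basis. If the complex random variables $a_{d/2},\dots,a_1$ (resp. $a_{(d-1)/2},\dots,a_0$) are independent, then they are Gaussian.
   Context: $dx$ is the normalized (total mass $1$) rotation-invariant measure on $\mathbb S^{d-1}$, and $L^2(\mathbb S^{d-1})$ is the corresponding space of complex-valued square integrable functions. $SO(d)$ acts on it by $L_gf(x)=f(g^{-1}x)$. In the Peter-Weyl decomposition of $L^2(\mathbb S^{d-1})$, $V_d$ denotes the smallest irreducible $SO(d)$-module other than the constants; it has dimension exactly $d$ and is stable under complex conjugation. A self-conjugated orthonormal basis is an orthonormal basis indexed as in the claim with $v_{-k}=\overline{v_k}$ for all $k$ (so $v_0$, present only when $d$ is odd, is real). A random field $T$ on $\mathbb S^{d-1}$ is a family $(T(x))_{x}$ of random variables on a probability space $(\Omega,\mathscr F,P)$ such that $(x,\omega)\mapsto T(x,\omega)$ is jointly measurable. It is a.s. square integrable if $\int|T(x)|^2dx<\infty$ a.s. An a.s. square integrable random field is called $SO(d)$-invariant if for every $g\in SO(d)$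 and every $x_1,\dots,x_m$ the vectors $(T(x_1),\dots,T(x_m))$ and $(T(gx_1),\dots,T(gx_m))$ have the same law. Invariant random fields are always a.s. square integrable by definition. A complex random variable $Z$ is called Gaussian (Gaussian complex valued) if $(\operatorname{Re}Z,\operatorname{Im}Z)$ is jointly Gaussian (degenerate Gaussian laws are allowed). Independence of the real and imaginary parts of a single coefficient is not assumed. *)

(* Defs.v *)
From HB Require Import structures.
From mathcomp Require Import all_boot all_order all_algebra.
From mathcomp Require Import complex.
From mathcomp Require Import all_classical all_reals all_analysis.

Set Implicit Arguments.
Unset Strict Implicit.
Unset Printing Implicit Defensive.
Import Order.TTheory GRing.Theory Num.Theory.
Import numFieldNormedType.Exports.
Import complex.

Local Open Scope classical_set_scope.
Local Open Scope ring_scope.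
Local Open Scope complex_scope.

Definition sphere_set (R : realType) (n : nat) : set 'cV[R]_n.+1 :=
  [set x | \sum_i x i 0 ^+ 2 = 1].
Arguments sphere_set : clear implicits.

(* S^n, contained in R^(n+1): the sphere S^(d-1) is [sphere R d.-1] for 0 < d.
   The shift makes the type inhabited, as measurableType requires. *)
Definition sphere (R : realType) (n : nat) : Type :=
  set_type (sphere_set R n).

Lemma north_pole_subproof (R : realType) (n : nat) :
  (delta_mx 0 0 : 'cV[R]_n.+1) \in sphere_set R n.
Proof.
rewrite inE /sphere_set/= (bigD1 0)//= big1 ?addr0 ?mxE ?expr1n//.
by move=> i /negPf i0; rewrite mxE i0 expr0n.
Qed.

HB.instance Definition _ (R : realType) (n : nat) :=
  Topological.copy (sphere R n) (set_type (sphere_set R n)).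
HB.instance Definition _ (R : realType) (n : nat) :=
  isPointed.Build (sphere R n)
    (exist (fun x => x \in sphere_set R n) _ (north_pole_subproof R n)).

Section sphere_borel.
Variables (R : realType) (n : nat).

Let borel : set (set (sphere R n)) := <<s @open (sphere R n) >>.

Let borel0 : borel set0.
Proof. exact: sigma_algebra0. Qed.

Let borelC A : borel A -> borel (~` A).
Proof. exact: sigma_algebraC. Qed.

Let borel_bigcup (F : (set (sphere R n))^nat) :
  (forall i, borel (F i)) -> borel (\bigcup_i F i).
Proof. exact: sigma_algebra_bigcup. Qed.

HB.instance Definition _ :=
  @isMeasurable.Build (sigma_display (@open (sphere R n)))
    (sphere R n) borel borel0 borelC borel_bigcup.

End sphere_borel.

(* SO(n+1), acting on S^n *)
Definition SO (R : realType) (n : nat) : Type :=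
  {g : 'M[R]_n.+1 | (g^T *m g == 1%:M) && (\det g == 1)}.

Lemma SO_inv_subproof (R : realType) (n : nat) (g : SO R n) :
  ((invmx (sval g))^T *m invmx (sval g) == 1%:M) &&
  (\det (invmx (sval g)) == 1).
Proof.
case: g => g /= /andP[/eqP gTg /eqP detg].
have gU : g \in unitmx by rewrite unitmxE detg unitr1.
have -> : invmx g = g^T by rewrite -[RHS]mulmx1 -(mulmxV gU) mulmxA gTg mul1mx.
by rewrite trmxK det_tr detg (mulmx1C gTg) !eqxx.
Qed.

Definition SO_inv (R : realType) (n : nat) (g : SO R n) : SO R n :=
  exist (fun h : 'M[R]_n.+1 => (h^T *m h == 1%:M) && (\det h == 1))
    (invmx (sval g)) (SO_inv_subproof g).

Lemma SO_act_subproof (R : realType) (n : nat) (g : SO R n) (x : sphere R n) :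
  sval g *m sval x \in sphere_set R n.
Proof.
case: g => g /= /andP[/eqP gTg _]; case: x => x /=; rewrite !inE /sphere_set/=.
have sqE (y : 'cV[R]_n.+1) : \sum_i y i 0 ^+ 2 = (y^T *m y) 0 0.
  by rewrite mxE; apply: eq_bigr => i _; rewrite mxE expr2.
by rewrite !sqE trmx_mul mulmxA -(mulmxA x^T) gTg mulmx1.
Qed.

Definition SO_act (R : realType) (n : nat) (g : SO R n) (x : sphere R n) :
    sphere R n :=
  exist (fun y => y \in sphere_set R n) (sval g *m sval x) (SO_act_subproof g x).

(* Among probability measures on S^n, n > 0, this characterizes the normalized
   surface measure. *)
Definition rotation_invariant (R : realType) (n : nat)
    (sigma : probability (sphere R n) R) :=
  forall (g : SO R n) (A : set (sphere R n)), measurable A ->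
    pushforward sigma (SO_act g) A = sigma A.

Definition Cintegral d (T : measurableType d) (R : realType)
    (mu : {measure set T -> \bar R}) (f : T -> R[i]) : R[i] :=
  Rintegral mu setT (fun x => Re (f x)) +i*
  Rintegral mu setT (fun x => Im (f x)).

(* Elements of L^2 are represented by functions, equality being almost
   everywhere; subspaces of L^2 are saturated sets of representatives. *)
Section L2_sphere.
Variables (R : realType) (n : nat) (sigma : probability (sphere R n) R).
Implicit Types (f g : sphere R n -> R[i]) (V W U : set (sphere R n -> R[i])).

Definition L2 : set (sphere R n -> R[i]) :=
  [set f : sphere R n -> R[i] |
     [/\ measurable_fun setT (fun x => Re (f x) : R),
         measurable_fun setT (fun x => Im (f x) : R) &
         (\int[sigma]_x (Re (f x) ^+ 2 + Im (f x) ^+ 2)%:E < +oo)%E]].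

Definition eqL2 f g := {ae sigma, forall x, f x = g x}.

Definition inner f g : R[i] := Cintegral sigma (fun x => f x * (g x)^*).

Definition L2_subspace V :=
  [/\ V `<=` L2,
      V (fun=> 0),
      forall (a : R[i]) f g, V f -> V g -> V (fun x => a * f x + g x) &
      forall f g, V f -> L2 g -> eqL2 f g -> V g].

Definition translate (h : SO R n) f : sphere R n -> R[i] :=
  fun x => f (SO_act (SO_inv h) x).

Definition SO_module V :=
  L2_subspace V /\ forall h f, V f -> V (translate h f).

(* No closedness of U is required: it is automatic for the finite-dimensional
   modules, the only ones considered below. *)
Definition irreducible_module V :=
  [/\ SO_module V,
      exists2 f, V f & ~ eqL2 f (fun=> 0) &
      forall U, SO_module U -> U `<=` V ->
        (forall f, U f -> eqL2 f (fun=> 0)) \/ U = V].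

Definition spans (I : eqType) (s : seq I) (e : I -> sphere R n -> R[i]) V :=
  forall f, V f ->
    exists c : I -> R[i], eqL2 f (fun x => \sum_(i <- s) c i * e i x).

Definition has_dimension V (m : nat) :=
  exists e : 'I_m -> sphere R n -> R[i],
    [/\ forall i, V (e i),
        forall c : 'I_m -> R[i],
          eqL2 (fun x => \sum_(i < m) c i * e i x) (fun=> 0) ->
          forall i, c i = 0 &
        spans (enum 'I_m) e V].

Definition constants : set (sphere R n -> R[i]) :=
  [set f | L2 f /\ exists c : R[i], eqL2 f (fun=> c)].

(* "The smallest" is meant strictly: in the Peter-Weyl decomposition of
   L^2(S^(d-1)), d >= 3, every irreducible module occurs once and the module of
   harmonics of degree l has a dimension strictly increasing in l. *)
Definition smallest_nonconstant_irreducible V (d : nat) :=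
  [/\ irreducible_module V, V <> constants, has_dimension V d &
      forall W m, irreducible_module W -> W <> constants ->
        has_dimension W m -> W <> V -> (d < m)%N].

End L2_sphere.

(* -d/2, ..., -1, 1, ..., d/2 for d even,
   -(d-1)/2, ..., 0, ..., (d-1)/2 for d odd *)
Definition indices (d : nat) : seq int :=
  [seq k <- [seq i%:Z - (d./2)%:Z | i <- iota 0 (d./2).*2.+1]
     | odd d || (k != 0)].

Definition nonneg_indices (d : nat) : seq nat :=
  [seq k <- iota 0 (d./2).+1 | odd d || (k != 0%N)].

Definition self_conjugated_orthonormal_basis (R : realType) (n : nat)
    (sigma : probability (sphere R n) R) (V : set (sphere R n -> R[i]))
    (d : nat) (v : int -> sphere R n -> R[i]) :=
  [/\ forall k, k \in indices d -> V (v k),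
      forall j k, j \in indices d -> k \in indices d ->
        inner sigma (v j) (v k) = (j == k)%:R,
      spans sigma (indices d) v V &
      forall k, k \in indices d ->
        eqL2 sigma (v (- k)) (fun x => (v k x)^*)].

Section random_fields.
Variables (R : realType) (n : nat) (sigma : probability (sphere R n) R).
Variables (dO : measure_display) (Omega : measurableType dO).
Variables (P : probability Omega R).
Implicit Type T : sphere R n -> Omega -> R.

Definition random_field T :=
  measurable_fun setT (fun xw : sphere R n * Omega => T xw.1 xw.2).

Definition as_square_integrable T :=
  {ae P, forall w, (\int[sigma]_x (`|T x w| ^+ 2)%:E < +oo)%E}.

Definition field_vector T m (x : 'I_m -> sphere R n) (w : Omega) :
    m.-tuple R :=
  [tuple T (x i) w | i < m].

Definition same_law_rotated T :=
  forall (g : SO R n) m (x : 'I_m -> sphere R n) (A : set (m.-tuple R)),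
    measurable A ->
    pushforward P (field_vector T (fun i => SO_act g (x i))) A =
    pushforward P (field_vector T x) A.

Definition invariant_random_field T :=
  [/\ random_field T, as_square_integrable T & same_law_rotated T].

Definition coefficient T (f : sphere R n -> R[i]) (w : Omega) : R[i] :=
  Cintegral sigma (fun x => (T x w)%:C * (f x)^*).

End random_fields.

Section complex_random_variables.
Variables (R : realType) (dO : measure_display) (Omega : measurableType dO).
Variables (P : probability Omega R).

Definition reim (z : R[i]) : R * R := (Re z, Im z).

(* Mutual independence of the family (Z k), k in s; Borel subsets of C are
   those of R * R. *)
Definition independent (I : choiceType) (s : seq I) (Z : I -> Omega -> R[i]) :=
  forall J : seq I, uniq J -> {subset J <= s} ->
  forall A : I -> set (R * R), (forall k, measurable (A k)) ->
    P (\bigcap_(k in [set` J]) ((fun w => reim (Z k w)) @^-1` A k)) =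
    (\prod_(k <- J) pushforward P (fun w => reim (Z k w)) (A k))%E.

(* N(m, s^2), including the Dirac mass at m when s = 0: [normal_prob m 0] is
   not that measure. *)
Definition gaussian_law (mu : set R -> \bar R) :=
  exists m s : R, forall A : set R, measurable A ->
    mu A = (if s == 0 then dirac m A else normal_prob m s A).

(* (Re Z, Im Z) is jointly Gaussian: all its linear combinations are Gaussian *)
Definition complex_gaussian (Z : Omega -> R[i]) :=
  [/\ measurable_fun setT (fun w => Re (Z w) : R),
      measurable_fun setT (fun w => Im (Z w) : R) &
      forall s t : R,
        gaussian_law (pushforward P (fun w => s * Re (Z w) + t * Im (Z w)))].

End complex_random_variables.

(* Main.v *)
Require Import Defs.
From HB Require Import structures.
From mathcomp Require Import all_boot all_order all_algebra.
From mathcomp Require Import complex.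
From mathcomp Require Import all_classical all_reals all_analysis.
From mathcomp Require Import measurable_realfun ring lra.

Set Implicit Arguments.
Unset Strict Implicit.
Unset Printing Implicit Defensive.
Import Order.TTheory GRing.Theory Num.Theory.
Import numFieldNormedType.Exports.

Local Open Scope classical_set_scope.
Local Open Scope ring_scope.

(** Write [n.+1] for the dimension [d]. The linear forms [x |-> c.x], with [c]
    a complex vector, restrict to an irreducible module of dimension [n.+1] on
    the sphere, so the smallest module [V] is this one
    ([smallest_module_linear_forms]). Let [A] be the random real vector [\int
    T(x) x dx]. The coefficient of [T] along [v k = c_k.x] is [conj c_k . A],
    and orthonormality of the self-conjugated basis says that the real and
    imaginary parts of the vectors [c_k] for distinct nonnegative indices are
    orthogonal real vectors. As [d >= 3], there are at least two such indices.
    So [A] has a rotation invariant law, and independent projections onto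
    orthogonal subspaces: by the Herschel-Maxwell argument it is Gaussian.

    In terms of characteristic functions, invariance gives [E exp(i xi.A) =
    f(|xi|)] for [xi] in the plane of orthogonal unit vectors [p], [q] taken
    from two of these subspaces. This [f] is real because [- xi] is a rotation
    of [xi]. Independence gives [f(r) = f(r cos t) f(r sin t)], whence [f(r) =
    exp(- k r^2)] ([herschel_maxwell], [field_cf_gaussian]). This is the
    characteristic function of a normal law ([cf_normal]), and it determines
    the law ([cf_unique]): smoothing a law by a small normal noise gives a
    density which is an integral of its characteristic function.

    The rotation invariance of the law of [A] ([field_cf_SO]) has to be drawn
    from the finite-dimensional laws of a field which is only jointly
    measurable. For a bounded field, the moments of [\int T(x) f(x) dx] are
    iterated integrals of the moments of [T] at finitely many points
    ([mixed_moment_rec]) and they determine the law; the general case follows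
    by truncation. *)

(** * Means of bounded functions *)

Section bounded.
Context d (X : measurableType d) (R : realType) (P : probability X R).

Lemma integrable_bounded (f : X -> R) (M : R) :
  measurable_fun setT f -> (forall x, `|f x| <= M) ->
  P.-integrable setT (EFin \o f).
Proof.
move=> mf fM; apply: measurable_bounded_integrable => //.
  by rewrite (le_lt_trans (probability_le1 _ _)) ?ltry.
exists M; split; first exact: num_real.
by move=> N MN x _ /=; rewrite (le_trans (fM x))// ltW.
Qed.

Lemma mean_cst (r : R) : \int[P]_x r = r.
Proof.
rewrite Rintegral_cst//; have := probability_setT P; move=> /= ->.
by rewrite mulr1.
Qed.

Lemma le_norm_mean (f : X -> R) (M : R) : measurable_fun setT f ->
  (forall x, `|f x| <= M) -> `|\int[P]_x f x| <= M.
Proof.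
move=> mf fM.
have iP := integrable_bounded mf fM.
apply: (le_trans (le_normr_Rintegral _ iP)) => //.
rewrite -[leRHS]mean_cst.
apply: le_Rintegral => //.
- apply: (@integrable_bounded _ M); first exact: measurableT_comp.
  by move=> x; rewrite normr_id.
- by apply: (@integrable_bounded _ `|M|).
Qed.

Lemma ae_eq_mean (f g : X -> R) : measurable_fun setT f ->
  measurable_fun setT g -> {ae P, forall x, f x = g x} ->
  \int[P]_x f x = \int[P]_x g x.
Proof.
move=> mf mg fg; congr fine; apply: ae_eq_integral => //.
- exact/measurable_EFinP.
- exact/measurable_EFinP.
- by apply: filterS fg => x fgx _ /=; rewrite fgx.
Qed.

Lemma mean_distribution d' (Y : measurableType d') (h : {RV P >-> Y})
    (f : Y -> R) M : measurable_fun setT f -> (forall y, `|f y| <= M) ->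
  \int[distribution P h]_y f y = \int[P]_x f (h x).
Proof.
move=> mf fM; congr fine; rewrite integral_distribution//.
  exact/measurable_EFinP.
by apply: (@integrable_bounded (f \o h) M) => //=; exact: measurableT_comp.
Qed.

Lemma dominated_mean (F : nat -> X -> R) (f : X -> R) (M : R) :
  (forall n, measurable_fun setT (F n)) -> measurable_fun setT f ->
  (forall n x, `|F n x| <= M) ->
  {ae P, forall x, F n x @[n --> \oo] --> f x} ->
  \int[P]_x F n x @[n --> \oo] --> \int[P]_x f x.
Proof.
move=> mF mf FM Ff.
have [|||||i1 _ c] := @dominated_convergence _ _ _ P setT measurableT
  (fun n x => (F n x)%:E) (EFin \o f) (cst M%:E).
- by move=> n; exact/measurable_EFinP.
- exact/measurable_EFinP.
- by apply: filterS Ff => x Fx _; apply: cvg_EFin => //; exact: nearW.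
- exact: (@integrable_bounded (cst M) `|M|).
- by apply: aeW => x n _ /=; rewrite lee_fin.
apply: fine_cvg; rewrite fineK//.
exact: integrable_fin_num.
Qed.

End bounded.

Section fubini_bounded.
Context d (X : measurableType d) d' (Y : measurableType d') (R : realType).
Variables (P : probability X R) (Q : probability Y R).
Variables (f : X * Y -> R) (M : R).
Hypotheses (mf : measurable_fun setT f) (fM : forall z, `|f z| <= M).

Let mfx x : measurable_fun setT (fun y => f (x, y)).
Proof. exact: measurableT_comp mf (pair1_measurable x). Qed.

Let mfy y : measurable_fun setT (fun x => f (x, y)).
Proof. exact: measurableT_comp mf (pair2_measurable y). Qed.

Lemma integrable_prod_bounded : (P \x Q)%E.-integrable setT (EFin \o f).
Proof.
apply/integrable12ltyP; first exact/measurable_EFinP.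
have M0 : 0 <= M by exact: le_trans (fM point).
have h1 x : (\int[Q]_y `|(f (x, y))%:E| <= M%:E)%E.
  apply: (@le_trans _ _ (\int[Q]_y (cst M%:E) y))%E.
    apply: ge0_le_integral => //=.
    - exact/measurable_EFinP/measurableT_comp.
    - by move=> y _; rewrite lee_fin.
  rewrite integral_cst//; have := probability_setT Q; move=> /= ->.
  by rewrite mule1.
apply: (@le_lt_trans _ _ (\int[P]_x (cst M%:E) x))%E.
  apply: ge0_le_integral => //=.
  - by move=> x _; exact: integral_ge0.
  - apply: (@measurable_fun_fubini_tonelli_F _ _ _ _ _ Q
      (fun z => (`|f z|)%:E)) => //.
    exact/measurable_EFinP/measurableT_comp.
  - by move=> x _; exact: h1.
rewrite integral_cst//; have := probability_setT P; move=> /= ->.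
by rewrite mule1 ltry.
Qed.

Let fin1 x : (\int[Q]_y (f (x, y))%:E)%E \is a fin_num.
Proof. by apply: integrable_fin_num => //; exact: integrable_bounded. Qed.

Let fin2 y : (\int[P]_x (f (x, y))%:E)%E \is a fin_num.
Proof. by apply: integrable_fin_num => //; exact: integrable_bounded. Qed.

Lemma measurable_mean1 : measurable_fun setT (fun x => \int[Q]_y f (x, y)).
Proof.
by apply: measurableT_comp => //;
  exact: measurable_fubini_F integrable_prod_bounded.
Qed.

Lemma measurable_mean2 : measurable_fun setT (fun y => \int[P]_x f (x, y)).
Proof.
by apply: measurableT_comp => //;
  exact: measurable_fubini_G integrable_prod_bounded.
Qed.

Lemma Fubini_mean :
  \int[P]_x \int[Q]_y f (x, y) = \int[Q]_y \int[P]_x f (x, y).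
Proof.
congr fine.
rewrite [LHS](_ : _ = \int[P]_x \int[Q]_y (f (x, y))%:E)%E; last first.
  by apply: eq_integral => x _; rewrite /Rintegral fineK.
rewrite (Fubini integrable_prod_bounded); apply: eq_integral => y _.
by rewrite /Rintegral fineK//; exact: fin2.
Qed.

End fubini_bounded.

(** * The characteristic function of the normal law *)

Section normal_density.
Context (R : realType).
Implicit Types (m s t x : R).
Local Notation leb := (@lebesgue_measure R).

(** The Radon-Nikodym derivative of [normal_prob m s] is almost everywhere its
    density [normal_pdf m s]. *)
Lemma mean_normal_prob m s (f : R -> R) (M : R) :
  measurable_fun setT f -> (forall x, `|f x| <= M) ->
  \int[normal_prob m s]_x f x = \int[leb]_x (f x * normal_pdf m s x).
Proof.
move=> mf fM; congr fine.
have dom := @normal_prob_dominates R m s.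
have intf := integrable_bounded (normal_prob m s) mf fM.
rewrite -(Radon_Nikodym_change_of_variables dom measurableT intf).
apply: ae_eq_integral => //.
- apply: emeasurable_funM => //; exact/measurable_EFinP.
- apply/measurable_EFinP/measurable_funM => //; exact: measurable_normal_pdf.
rewrite [X in ae_eq _ _ _ X](_ : _ =
  (EFin \o f) \* (EFin \o normal_pdf m s))%E//.
apply: ae_eqe_mul2l.
apply: integral_ae_eq => //.
- exact: Radon_Nikodym_integrable.
- by apply/measurable_EFinP; exact: measurable_normal_pdf.
- move=> E _ mE; rewrite -Radon_Nikodym_integral//.
Qed.

Lemma normal_pdf_formula m s x : s != 0 ->
  normal_pdf m s x = normal_peak s * expR (- (x - m) ^+ 2 / (s ^+ 2 *+ 2)).
Proof. by move=> s0; rewrite /normal_pdf (negPf s0). Qed.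

Lemma is_derive_normal_pdf s x : s != 0 ->
  is_derive x 1 (normal_pdf 0 s) (- (x / s ^+ 2) * normal_pdf 0 s x).
Proof.
move=> s0.
have -> : normal_pdf 0 s =
    (fun y : R => normal_peak s * expR (- (s ^+ 2 *+ 2)^-1 * y ^+ 2)).
  apply/funext => y; rewrite normal_pdf_formula// subr0; congr (_ * expR _).
  by rewrite mulrC mulrN mulNr.
apply: is_derive_eq.
by rewrite /GRing.scale/= !mulr1; field.
Qed.

(** Doubling the variance absorbs the factor [|x|]: with [u = x^2 / 4s^2], [|x|
    <= 1 + x^2 <= (1 + 4s^2)(1 + u) <= (1 + 4s^2) exp u]. The bound serves to
    differentiate [\int cos(tx + c) n(x) dx] with respect to [t]. *)
Lemma normal_pdf_moment_bound s : s != 0 -> exists2 C : R, 0 <= C &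
  forall x, `|x| * normal_pdf 0 s x <= C * normal_pdf 0 (s * Num.sqrt 2) x.
Proof.
move=> s0; have s20 : s * Num.sqrt 2 != 0.
  by rewrite mulf_neq0// gt_eqF// sqrtr_gt0.
have p1 := normal_peak_gt0 s0; have p2 := normal_peak_gt0 s20.
exists ((1 + 4 * s ^+ 2) * (normal_peak s / normal_peak (s * Num.sqrt 2))).
  apply: mulr_ge0; last by rewrite divr_ge0 ?ltW.
  by rewrite addr_ge0// mulr_ge0// sqr_ge0.
move=> x; rewrite !normal_pdf_formula// subr0 exprMn sqr_sqrtr//.
set a := normal_peak s; set b := normal_peak _.
rewrite [leRHS](_ : _ =
  a * ((1 + 4 * s ^+ 2) * expR (- x ^+ 2 / (s ^+ 2 * 2 *+ 2)))); last first.
  by field; rewrite gt_eqF.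
rewrite mulrCA ler_pM2l//.
have s2 : 0 < s ^+ 2 by rewrite exprn_even_gt0.
set u := x ^+ 2 / (s ^+ 2 * 2 *+ 2).
have u0 : 0 <= u.
  by rewrite /u divr_ge0 ?sqr_ge0// mulrn_wge0// mulr_ge0// ltW.
have -> : - x ^+ 2 / (s ^+ 2 * 2 *+ 2) = - u by rewrite mulNr.
have -> : - x ^+ 2 / (s ^+ 2 *+ 2) = - u - u.
  by rewrite /u; field.
rewrite expRD mulrA ler_pM2r ?expR_gt0// expRN ler_pdivrMr ?expR_gt0//.
apply: (@le_trans _ _ ((1 + 4 * s ^+ 2) * (1 + u))); last first.
  by rewrite ler_pM2l ?expR_ge1Dx// addr_gt0// mulr_gt0.
have xu : x ^+ 2 = 4 * s ^+ 2 * u by rewrite /u; field.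
apply: (@le_trans _ _ (1 + x ^+ 2)).
  by rewrite -[x ^+ 2]real_normK ?num_real//; have := sqr_ge0 (`|x| - 1); nra.
by rewrite xu; nra.
Qed.

(** The fundamental theorem of calculus on [`[-n, n]], and dominated
    convergence as [n] grows. *)
Lemma integral_derivative_vanish (F f : R -> R) :
  (forall x, is_derive x 1 F (f x)) -> continuous f ->
  leb.-integrable setT (EFin \o f) ->
  F n%:R - F (- n%:R) @[n --> \oo] --> (0 : R) ->
  \int[leb]_x f x = 0.
Proof.
move=> dF cf intf F0.
have cF : continuous F.
  by move=> x; apply: differentiable_continuous; exact/derivable1_diffP.
have mf : measurable_fun setT f := continuous_measurable_fun cf.
pose I n : set R := `[- n%:R, n%:R]%classic.
have FTC n : (\int[leb]_(x in I n.+1) (f x)%:E =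
  (F n.+1%:R - F (- n.+1%:R))%:E)%E.
  rewrite (@continuous_FTC2 _ f F) ?EFinB//.
  - by rewrite -subr_gt0 opprK.
  - by apply: continuous_subspaceT => x; exact: cf.
  - split; first by move=> x _; have := dF x.
    + by apply: cvg_at_right_filter; exact: cF.
    + by apply: cvg_at_left_filter; exact: cF.
  - by move=> x _; rewrite derive1E; have /@derive_val := dF x.
have cvgf : (\int[leb]_x ((f \_ (I n.+1)) x)%:E)%E @[n --> \oo] -->
  (\int[leb]_x (f x)%:E)%E.
  have [|||||_ _ c] := @dominated_convergence _ _ _ leb setT measurableT
    (fun n x => ((f \_ (I n.+1)) x)%:E) (EFin \o f) (fun x => `|f x|%:E).
  - move=> n; apply/measurable_EFinP/(measurable_restrictT _ _).1 => //.
      exact: measurable_itv.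
    exact: measurable_funTS mf.
  - exact/measurable_EFinP.
  - apply: aeW => x _; apply: cvg_near_cst.
    exists (Num.trunc `|x|) => // n /= xn; rewrite patchE mem_set//.
    rewrite /I/= in_itv/= -ler_norml.
    by apply: ltW; rewrite -truncn_le_nat.
  - exact: (integrable_abse intf).
  - by apply: aeW => x n _; rewrite /= lee_fin patchE; case: ifP => _;
      rewrite ?normr0.
  exact: c.
have E n : (\int[leb]_x ((f \_ (I n.+1)) x)%:E =
  (F n.+1%:R - F (- n.+1%:R))%:E)%E.
  by rewrite -FTC [RHS]integral_mkcond restrict_EFin.
have cvg0 : (F n.+1%:R - F (- n.+1%:R))%:E @[n --> \oo] --> (0 : R)%:E.
  apply: cvg_EFin; first exact: nearW.
  by have := F0; rewrite -cvg_shiftS.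
have : (\int[leb]_x (f x)%:E)%E = 0%:E.
  apply: (cvg_unique _ cvgf) => //.
  by move: cvg0; apply: cvg_trans; apply: near_eq_cvg; near=> n; rewrite E.
by rewrite /Rintegral => ->.
Unshelve. all: end_near. Qed.

End normal_density.

Section normal_cf.
Context (R : realType).
Implicit Types (m s t x : R).
Local Notation leb := (@lebesgue_measure R).

Let affine_continuous t c : continuous (fun x : R => t * x + c : R).
Proof. by move=> x; apply: cvgD; [exact: mulrl_continuous|exact: cvg_cst]. Qed.

Lemma continuous_cosM t c : continuous (fun x : R => cos (t * x + c)).
Proof.
move=> x; apply: (@continuous_comp _ _ _ (fun y => t * y + c) cos).
  exact: affine_continuous.
exact: continuous_cos.
Qed.

Lemma continuous_sinM t c : continuous (fun x : R => sin (t * x + c)).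
Proof.
move=> x; apply: (@continuous_comp _ _ _ (fun y => t * y + c) sin).
  exact: affine_continuous.
exact: continuous_sin.
Qed.

Lemma measurable_cosM t c : measurable_fun setT (fun x : R => cos (t * x + c)).
Proof. by apply: continuous_measurable_fun; exact: continuous_cosM. Qed.

Lemma measurable_sinM t c : measurable_fun setT (fun x : R => sin (t * x + c)).
Proof. by apply: continuous_measurable_fun; exact: continuous_sinM. Qed.

Lemma continuous_cosD c : continuous (fun x : R => cos (x + c)).
Proof.
rewrite (_ : (fun _ => _) = fun x => cos (1 * x + c)).
  exact: continuous_cosM.
by apply/funext => x; rewrite mul1r.
Qed.

Lemma measurable_cosD c : measurable_fun setT (fun x : R => cos (x + c)).
Proof. by apply: continuous_measurable_fun; exact: continuous_cosD. Qed.

Let intM (g h : R -> R) : measurable_fun setT g ->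
  (forall x, `|g x| <= h x) -> leb.-integrable setT (EFin \o h) ->
  leb.-integrable setT (EFin \o g).
Proof.
move=> mg gh; apply: le_integrable => //; first exact/measurable_EFinP.
move=> x _ /=; rewrite lee_fin (le_trans (gh x))// ler_norm//.
Qed.

Section fixed_variance.
Variables (s c : R) (s0 : s != 0).
Local Notation n := (normal_pdf 0 s : R -> R).

Let n0 x : 0 <= n x. Proof. exact: normal_pdf_ge0. Qed.
Let mn : measurable_fun setT n. Proof. exact: measurable_normal_pdf. Qed.
Let intn : leb.-integrable setT (EFin \o n).
Proof. exact: integrable_normal_pdf. Qed.

Let int_xn : leb.-integrable setT (EFin \o (fun x => `|x| * n x)).
Proof.
have [C C0 xnC] := normal_pdf_moment_bound s0.
apply: (@intM _ (fun x => C * normal_pdf 0 (s * Num.sqrt 2) x)).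
- apply: measurable_funM => //; exact: normr_measurable.
- by move=> x; rewrite ger0_norm ?mulr_ge0.
- have := integrableZl measurableT C (integrable_normal_pdf 0 (s * Num.sqrt 2)).
  exact.
Qed.

Let int_cos t : leb.-integrable setT (EFin \o (fun x => cos (t * x + c) * n x)).
Proof.
apply: intM intn.
  by apply: measurable_funM => //; exact: measurable_cosM.
by move=> x; rewrite normrM (ger0_norm (n0 x)) ler_piMl// cos_max.
Qed.

Let int_xsin t : leb.-integrable setT (EFin \o (fun x =>
  - (x * sin (t * x + c)) * n x)).
Proof.
apply: intM int_xn.
  apply: measurable_funM => //; apply: measurable_funN.
  by apply: measurable_funM => //; exact: measurable_sinM.
move=> x; rewrite normrM (ger0_norm (n0 x)) normrN normrM.
by rewrite ler_wpM2r// ler_piMr// sin_max.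
Qed.

Let phi t := \int[leb]_x (cos (t * x + c) * n x).

Let dphi_int t : is_derive t 1 phi (\int[leb]_x (- (x * sin (t * x + c)) * n
  x)).
Proof.
pose f (u x : R) : R := cos (u * x + c) * n x.
have df (u x : R) : is_derive u 1 (f ^~ x : R ->
  R) (- (x * sin (u * x + c)) * n x).
  apply: is_derive_eq; rewrite /GRing.scale/=; ring.
have d1 u x : partial1of2 f u x = - (x * sin (u * x + c)) * n x.
  by rewrite partial1of2E; have /@derive_val := df u x.
have I : [set` `]t - 1, t + 1[] t by rewrite /= in_itv/=; lra.
have H1 : forall x, [set` `]t - 1, t + 1[] x ->
  leb.-integrable setT (EFin \o f x).
  by move=> u _; exact: int_cos.
have H2 : forall u x, [set` `]t - 1, t + 1[] u -> setT x ->
  derivable (f ^~ x) u 1.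
  by move=> u x _ _; have /@ex_derive := df u x.
have H3 : forall u x, [set` `]t - 1, t + 1[] u -> setT x ->
  `|partial1of2 f u x| <= `|x| * n x.
  move=> u x _ _; rewrite d1 normrM (ger0_norm (n0 x)) normrN normrM.
  by rewrite ler_wpM2r// ler_piMr// sin_max.
have H0 x : 0 <= `|x| * n x by rewrite mulr_ge0.
apply: DeriveDef.
  exact: (derivable_under_integral measurableT I H1 H2 H0 int_xn H3).
rewrite -derive1E (differentiation_under_integral measurableT I H1 H2 H0 int_xn
  H3).
by apply: eq_Rintegral => x _; rewrite d1.
Qed.

(** [x n(x)] is the derivative of [- s^2 n(x)]: integrate that of [n(x) sin(tx
    + c)]. *)
Let by_parts t :
  \int[leb]_x (- (x * sin (t * x + c)) * n x) = - (s ^+ 2 * t) * phi t.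
Proof.
pose F x := n x * sin (t * x + c).
pose f x := s ^- 2 * (- (x * sin (t * x + c)) * n x) + t * (cos (t * x + c) * n
  x).
have dn := fun x => is_derive_normal_pdf x s0.
have dF x : is_derive x 1 F (f x).
  apply: is_derive_eq; rewrite /GRing.scale/= /f; ring.
have cn : continuous n by exact: continuous_normal_pdf.
have csin := @continuous_sinM t c.
have ccos := @continuous_cosM t c.
have cf : continuous f.
  move=> x; apply: cvgD; apply: cvgM; [exact: cvg_cst| |exact: cvg_cst|].
    apply: cvgM; last exact: cn.
    by apply: cvgN; apply: cvgM; [exact: cvg_id|exact: csin].
  by apply: cvgM; [exact: ccos|exact: cn].
have i1 := int_xsin t; have i2 := int_cos t.
have intf : leb.-integrable setT (EFin \o f).
  have j1 := integrableZl measurableT (s ^- 2) i1.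
  have j2 := integrableZl measurableT t i2.
  exact: (integrableD measurableT j1 j2).
have [C C0 xnC] := normal_pdf_moment_bound s0.
have s20 : s * Num.sqrt 2 != 0 by rewrite mulf_neq0// gt_eqF// sqrtr_gt0.
pose K := C * normal_peak (s * Num.sqrt 2).
have nK (x : R) : 0 < `|x| -> n x <= K / `|x|.
  move=> x0; rewrite ler_pdivlMr// mulrC (le_trans (xnC x))//.
  by rewrite ler_wpM2l// normal_pdf_ub.
have FK (x : R) : 0 < `|x| -> `|F x| <= K / `|x|.
  move=> x0; rewrite normrM (ger0_norm (n0 x)) (le_trans _ (nK _ x0))//.
  by rewrite ler_piMr// sin_max.
have F0 : F k%:R - F (- k%:R) @[k --> \oo] --> (0 : R).
  rewrite -cvg_shiftS; apply: norm_cvg0.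
  have K0 : (K + K) * harmonic k @[k --> \oo] --> (0 : R).
    rewrite -[X in _ --> X](mulr0 (K + K)).
    by apply: cvgM; [exact: cvg_cst|exact: cvg_harmonic].
  apply: (squeeze_cvgr _ (cvg_cst 0) K0); near=> k.
  rewrite normr_ge0/= (le_trans (ler_normB _ _))// mulrDl lerD//.
    by rewrite (le_trans (FK _ _))// normr_nat.
  by rewrite (le_trans (FK _ _))// normrN normr_nat.
have := integral_derivative_vanish dF cf intf F0.
rewrite /f RintegralD//; last 2 first.
- exact: (integrableZl measurableT (s ^- 2) i1).
- exact: (integrableZl measurableT t i2).
rewrite !RintegralZl// -/(phi t) => H.
have s2 : s ^+ 2 != 0 by rewrite expf_neq0.
move/(congr1 (fun z => s ^+ 2 * z)): H;
  rewrite mulr0 mulrDr mulrA divff// mul1r.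
by move/eqP; rewrite addr_eq0 => /eqP ->; rewrite mulNr mulrA.
Unshelve. all: end_near. Qed.

(** As a function of [t] the left-hand side solves [phi' = - s^2 t phi], so
    that [phi(t) exp(s^2 t^2 / 2)] is constant. The phase [c] gives the real
    part of the characteristic function at [c = 0], and the imaginary part at
    [c = - pi / 2]. *)
Lemma cf_normal t :
  \int[normal_prob 0 s]_x cos (t * x + c) =
    cos c * expR (- (s ^+ 2 * t ^+ 2 / 2)).
Proof.
rewrite (@mean_normal_prob _ _ _ _ 1); last 2 first.
- exact: measurable_cosM.
- by move=> x; exact: cos_max.
pose psi (t : R) : R := phi t * expR (s ^+ 2 * t ^+ 2 / 2).
have dphi u := dphi_int u.
have dpsi (u : R) : is_derive u 1 psi 0.
  by apply: is_derive_eq; rewrite by_parts /GRing.scale/=; field.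
have phi0 : phi 0 = cos c.
  rewrite /phi; under eq_Rintegral do rewrite mul0r add0r.
  rewrite RintegralZl// [X in _ * X](_ : _ = 1) ?mulr1//.
  by rewrite /Rintegral integral_normal_pdf.
have : psi t = psi 0.
  exact: is_derive_0_is_cst.
rewrite /psi phi0 expr0n/= mulr0 mul0r expR0 mulr1 => /(canRL (mulfK _)).
by rewrite gt_eqF ?expR_gt0// -expRN; apply.
Qed.

End fixed_variance.
End normal_cf.

(** * Characteristic functions determine laws *)

Section smoothing.
Context (R : realType).
Local Notation leb := (@lebesgue_measure R).
Local Notation RT := (measurableTypeR R).
Implicit Types (mu nu : probability RT R).

(** A normal density is, up to a factor, the characteristic function of a
    normal law. This expresses the smoothing of a law by a small normal noise
    through the characteristic function of that law. *)
Lemma normal_pdf_cos (e x y : R) : e != 0 -> normal_pdf x e y =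
  normal_peak e * \int[normal_prob 0 e^-1]_z cos ((y - x) * z + 0).
Proof.
move=> e0; rewrite cf_normal ?invr_neq0// normal_pdf_formula// cos0 mul1r.
by congr (_ * expR _); field.
Qed.

Lemma measurable_normal_pdf2 (e : R) : e != 0 ->
  measurable_fun setT (fun z : RT * RT => normal_pdf z.1 e z.2).
Proof.
move=> e0; rewrite (_ : (fun _ => _) = fun z : RT * RT =>
  normal_peak e * expR (- (z.2 - z.1) ^+ 2 / (e ^+ 2 *+ 2))); last first.
  by apply/funext => z; rewrite normal_pdf_formula.
apply: measurable_funM => //; apply: measurableT_comp => //.
apply: measurable_funM => //; apply: measurable_funN.
by apply: measurable_funX; apply: measurable_funB.
Qed.

Lemma smoothed_density mu (e y : R) : e != 0 -> \int[mu]_x normal_pdf x e y =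
  normal_peak e *
  \int[normal_prob 0 e^-1]_z \int[mu]_x cos (- z * x + y * z).
Proof.
move=> e0; under eq_Rintegral do rewrite normal_pdf_cos//.
pose f (w : RT * RT) := (cos ((y - w.1) * w.2 + 0 : R) : R).
have mf : measurable_fun setT f.
  apply: measurableT_comp.
    by apply: continuous_measurable_fun; exact: continuous_cos.
  apply: measurable_funD => //; apply: measurable_funM => //.
  exact: measurable_funB.
have f1 w : `|f w| <= 1 by exact: cos_max.
rewrite RintegralZl//; last first.
  apply: (@integrable_bounded _ _ _ mu _ 1) => //.
    exact: (measurable_mean1 mu (normal_prob 0 e^-1) mf f1).
  by move=> x; apply: le_norm_mean; [exact: measurable_cosM|move=> z;
    exact: cos_max].
congr (_ * _).
rewrite (Fubini_mean mu (normal_prob 0 e^-1) mf f1).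
apply: eq_Rintegral => z _; apply: eq_Rintegral => x _; congr cos.
by rewrite /=; ring.
Qed.

Lemma measurable_normal_prob (e : R) (A : set RT) : e != 0 -> measurable A ->
  measurable_fun setT (fun x : RT => normal_prob x e A).
Proof.
move=> e0 mA.
pose f (w : RT * RT) := (normal_pdf w.1 e w.2 * \1_A w.2)%:E.
have mf : measurable_fun setT f.
  apply/measurable_EFinP; apply: measurable_funM;
    first exact: measurable_normal_pdf2.
  by apply: measurableT_comp => //; exact: measurable_indic.
have f0 w : (0 <= f w)%E by rewrite lee_fin mulr_ge0// normal_pdf_ge0.
have := measurable_fun_fubini_tonelli_F (m2 := leb) f mf f0.
congr (measurable_fun _ _); apply/funext => x.
rewrite /fubini_F /f /normal_prob [RHS]integral_mkcond;
  apply: eq_integral => y _.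
by rewrite patchE indicE; case: ifP => _; rewrite ?mulr1 ?mulr0.
Qed.

(** The left-hand side is the mass of [A] under the convolution of [mu] with
    the normal law of variance [e^2]. *)
Lemma smoothed_measure mu (e : R) (A : set RT) : e != 0 -> measurable A ->
  (\int[mu]_x normal_prob x e A =
    \int[leb]_(y in A) (\int[mu]_x normal_pdf x e y)%:E)%E.
Proof.
move=> e0 mA.
pose f (w : RT * RT) := (normal_pdf w.1 e w.2 * \1_A w.2)%:E.
have mf : measurable_fun setT f.
  apply/measurable_EFinP; apply: measurable_funM;
    first exact: measurable_normal_pdf2.
  by apply: measurableT_comp => //; exact: measurable_indic.
have f0 w : (0 <= f w)%E by rewrite lee_fin mulr_ge0// normal_pdf_ge0.
transitivity (\int[mu]_x \int[leb]_y f (x, y))%E.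
  apply: eq_integral => x _; rewrite /normal_prob integral_mkcond;
    apply: eq_integral => y _.
  by rewrite patchE /f/= indicE; case: ifP => _; rewrite ?mulr1 ?mulr0.
rewrite (fubini_tonelli (m1 := mu) (m2 := leb) f mf f0) [RHS]integral_mkcond.
apply: eq_integral => y _; rewrite patchE /f/= indicE; case: ifP => _.
  under eq_integral do rewrite mulr1.
  rewrite /Rintegral fineK//.
  apply: integrable_fin_num => //.
  apply: (@integrable_bounded _ _ _ mu (fun x =>
    normal_pdf x e y) (normal_peak e)).
    exact: (measurableT_comp (measurable_normal_pdf2 e0) (pair2_measurable y)).
  by move=> x; rewrite ger0_norm ?normal_pdf_ge0// normal_pdf_ub.
by under eq_integral do rewrite mulr0; rewrite integral0.
Qed.

(** Equality of the characteristic functions, in real terms: the phase [c]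
    replaces the pair of real and imaginary parts. *)
Definition same_cf mu nu := forall t c : R,
  \int[mu]_x cos (t * x + c) = \int[nu]_x cos (t * x + c).

Section same_cf_facts.
Variables mu nu : probability RT R.
Hypothesis cf : same_cf mu nu.

Lemma same_smoothed_density (e y : R) : e != 0 ->
  \int[mu]_x normal_pdf x e y = \int[nu]_x normal_pdf x e y.
Proof.
move=> e0; rewrite !smoothed_density//; congr (_ * _).
by apply: eq_Rintegral => z _; exact: cf.
Qed.

Lemma same_smoothed_measure (e : R) (A : set RT) : e != 0 -> measurable A ->
  (\int[mu]_x normal_prob x e A = \int[nu]_x normal_prob x e A)%E.
Proof.
move=> e0 mA; rewrite !smoothed_measure//.
by apply: eq_integral => y _; rewrite same_smoothed_density.
Qed.

End same_cf_facts.

(** Bounds the mass of N(x, e^2) at distance at least [d] from [x]. *)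
Definition normal_tail (e d : R) : R := Num.sqrt 2 * expR (- (d / e) ^+ 2 / 4).

(** At distance at least [d] from [x], half of the exponent of the density
    gives the exponential factor of [normal_tail e d]; what remains of the
    density is, up to the factor [sqrt 2], a normal density of variance [2
    e^2]. *)
Lemma normal_tailP (x e d : R) (A : set RT) : e != 0 -> 0 <= d ->
  measurable A ->
  (forall y, A y -> d <= `|y - x|) ->
  (normal_prob x e A <= (normal_tail e d)%:E)%E.
Proof.
move=> e0 d0 mA Ad; have e20 : e * Num.sqrt 2 != 0.
  by rewrite mulf_neq0// gt_eqF// sqrtr_gt0.
pose g y := normal_tail e d * normal_pdf x (e * Num.sqrt 2) y.
have t0 : 0 <= normal_tail e d by rewrite mulr_ge0 ?sqrtr_ge0 ?expR_ge0.
have peakE : normal_peak e = Num.sqrt 2 * normal_peak (e * Num.sqrt 2).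
  rewrite /normal_peak exprMn sqr_sqrtr// (_ : e ^+ 2 * 2 * pi *+ 2 =
    2 * (e ^+ 2 * pi *+ 2)); last by ring.
  rewrite sqrtrM// invfM mulrA divff ?mul1r// gt_eqF// sqrtr_gt0//.
apply: (@le_trans _ _ (\int[leb]_y (g y)%:E)%E).
  rewrite /normal_prob integral_mkcond; apply: ge0_le_integral => //.
  - by move=> y _; rewrite patchE; case: ifP => // _;
      rewrite lee_fin normal_pdf_ge0.
  - apply/(measurable_restrictT _ _).1 => //; apply: measurable_funTS.
    by apply/measurable_EFinP; exact: measurable_normal_pdf.
  - apply/measurable_EFinP; apply: measurable_funM => //;
      exact: measurable_normal_pdf.
  - move=> y _; rewrite patchE; case: ifPn => [/set_mem /Ad dy|_]; last first.
      by rewrite lee_fin mulr_ge0// normal_pdf_ge0.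
    rewrite lee_fin /g !normal_pdf_formula// peakE /normal_tail.
    have e2 : 0 < e ^+ 2 by rewrite exprn_even_gt0.
    have de : expR (- (y - x) ^+ 2 / (e ^+ 2 *+ 2)) <= expR (- (d / e) ^+ 2 /
      4) *
        expR (- (y - x) ^+ 2 / ((e * Num.sqrt 2) ^+ 2 *+ 2)).
      have -> : (e * Num.sqrt 2) ^+ 2 = e ^+ 2 * 2 by rewrite exprMn sqr_sqrtr.
      rewrite -expRD ler_expR.
      have yx : d ^+ 2 <= (y - x) ^+ 2.
        by rewrite -[leRHS]real_normK ?num_real// lerXn2r ?nnegrE.
      rewrite -subr_ge0 [leRHS](_ : _ =
        ((y - x) ^+ 2 - d ^+ 2) / (4 * e ^+ 2)); last by field.
      by rewrite divr_ge0 ?subr_ge0// mulr_ge0// ltW.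
    rewrite [leRHS]mulrACA; apply: ler_wpM2l => //.
    by rewrite mulr_ge0 ?sqrtr_ge0 ?normal_peak_ge0.
rewrite /g; under eq_integral do rewrite EFinM.
rewrite integralZl//; last exact: integrable_normal_pdf.
by rewrite integral_normal_pdf mule1.
Qed.

End smoothing.

Section uniqueness.
Context (R : realType).
Local Notation leb := (@lebesgue_measure R).
Local Notation RT := (measurableTypeR R).
Implicit Types (mu nu : probability RT R).

Let ge0_normal_prob (e x : R) (A : set RT) : (0 <= normal_prob x e A)%E.
Proof. by apply: integral_ge0 => y _; rewrite lee_fin normal_pdf_ge0. Qed.

Let normal_tail_ge0 (e d : R) : 0 <= normal_tail e d.
Proof. by rewrite mulr_ge0 ?sqrtr_ge0 ?expR_ge0. Qed.

Let integralDcst mu (g : RT -> \bar R) (r : R) : measurable_fun setT g ->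
  (forall x, 0 <= g x)%E -> 0 <= r ->
  (\int[mu]_x (g x + r%:E) = \int[mu]_x g x + r%:E)%E.
Proof.
move=> mg g0 r0; rewrite ge0_integralD//; congr (_ + _)%E.
rewrite (integral_cst mu measurableT r%:E).
by have := probability_setT mu; move=> /= ->; rewrite mule1.
Qed.

Let integral_indicD mu (B : set RT) (r : R) : measurable B -> 0 <= r ->
  (\int[mu]_x ((\1_B x)%:E + r%:E) = mu B + r%:E)%E.
Proof.
move=> mB r0; rewrite (@integralDcst mu (EFin \o \1_B))//.
- by rewrite integral_indic// setIT.
- exact/measurable_EFinP/measurable_indic.
- by move=> x; rewrite /= lee_fin.
Qed.

(** A normal noise exceeds [d] with probability at most [normal_tail e d],
    which bounds in both directions what smoothing can do to half-lines. *)
Lemma smoothed_le mu (b d e : R) : e != 0 -> 0 < d ->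
  (\int[mu]_x normal_prob x e `](b + d)%R, +oo[%classic <=
   mu `]b, +oo[%classic + (normal_tail e d)%:E)%E.
Proof.
move=> e0 d0; have mI (a : R) : measurable (`]a, +oo[%classic : set RT).
  exact: measurable_itv.
rewrite -integral_indicD//.
apply: ge0_le_integral => //.
- exact: measurable_normal_prob.
- by apply: emeasurable_funD => //; exact/measurable_EFinP/measurable_indic.
- move=> x _; rewrite indicE; case: (boolP (x \in _)) => [_|].
    rewrite (le_trans (probability_le1 (normal_prob x e) _))//.
    by rewrite -EFinD lee_fin lerDl.
  rewrite notin_setE/= in_itv/= andbT => /negP; rewrite -leNgt => xb.
  rewrite add0e; apply: normal_tailP => //; [exact: ltW|].
  move=> z /=; rewrite in_itv/= andbT => yb; rewrite ger0_norm; lra.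
Qed.

Lemma le_smoothed mu (b d e : R) : e != 0 -> 0 < d ->
  (mu `](b + d + d)%R, +oo[%classic <= \int[mu]_x normal_prob x e `](b + d)%R,
    +oo[%classic
                           + (normal_tail e d)%:E)%E.
Proof.
move=> e0 d0; set B := `](b + d + d)%R, +oo[%classic;
  set A := `](b + d)%R, +oo[%classic.
have mA : measurable A by exact: measurable_itv.
have mB : measurable B by exact: measurable_itv.
have mN := measurable_normal_prob e0 mA.
rewrite -integralDcst//.
have -> : mu B = (\int[mu]_x (\1_B x)%:E)%E by rewrite integral_indic// setIT.
apply: ge0_le_integral => //.
- exact/measurable_EFinP/measurable_indic.
- by apply: emeasurable_funD => //; exact: measurable_normal_prob.
- move=> x _; rewrite indicE; case: (boolP (x \in _)) => [|_]; last first.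
    by apply: adde_ge0; [exact: ge0_normal_prob|rewrite lee_fin].
  rewrite inE /B/= in_itv/= andbT => xb.
  have := probability_setC (normal_prob x e) (measurableC mA).
  rewrite setCK => ->; rewrite -leeBlDr ?lee_fin//.
  have tl : (normal_prob x e (~` A) <= (normal_tail e d)%:E)%E.
    apply: normal_tailP => //; [exact: ltW|exact: measurableC|].
    move=> y; rewrite /A/= in_itv/= andbT => /negP; rewrite -leNgt => yb.
    by rewrite ler0_norm; lra.
  by rewrite leeB.
Qed.

Lemma normal_tail_small (d eta : R) : 0 < d -> 0 < eta ->
  exists2 e : R, e != 0 & normal_tail e d <= eta.
Proof.
move=> d0 eta0; pose r := Num.min 1 (eta / 8).
have r0 : 0 < r by rewrite lt_min ltr01 divr_gt0.
exists (d * r); first by rewrite gt_eqF// mulr_gt0.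
rewrite /normal_tail.
have -> : - (d / (d * r)) ^+ 2 / 4 = - (r ^- 2 / 4).
  by field; rewrite !gt_eqF.
have u0 : 0 < r ^- 2 / 4 by rewrite divr_gt0// invr_gt0 exprn_gt0.
apply: (@le_trans _ _ (2 * (r ^- 2 / 4)^-1)).
  apply: ler_pM; rewrite ?sqrtr_ge0 ?expR_ge0//.
    rewrite -[leRHS]ger0_norm// -sqrtr_sqr ler_sqrt//; lra.
  rewrite expRN lef_pV2 ?posrE ?expR_gt0//.
  by apply: le_trans (expR_ge1Dx _); rewrite lerDr.
rewrite invfM invrK invrK.
have r1 : r <= 1 by rewrite ge_min lexx.
have r2 : r <= eta / 8 by rewrite ge_min lexx orbT.
have : r ^+ 2 <= r by rewrite expr2 ler_piMr// ltW.
by move=> ?; rewrite (_ : 2 * _ = r ^+ 2 * 8); [lra|ring].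
Qed.

(** Both laws have the same smoothings, so the mass of a half-line for [mu]
    exceeds that of a slightly larger half-line for [nu] by two tails at most.
    The tails vanish with the noise, then the shift of the half-line goes to 0.
    *)
Lemma same_cf_le mu nu (b : R) : same_cf mu nu ->
  (mu `]b, +oo[%classic <= nu `]b, +oo[%classic)%E.
Proof.
move=> cf.
have H (d : R) : 0 < d ->
  (mu `](b + d + d)%R, +oo[%classic <= nu `]b, +oo[%classic)%E.
  move=> d0; apply/lee_addgt0Pr => eta eta0.
  have eta2 : 0 < eta / 2 by rewrite divr_gt0.
  have [e e0 te] := normal_tail_small d0 eta2.
  rewrite (le_trans (le_smoothed mu b e0 d0))//.
  rewrite (same_smoothed_measure cf e0)//.
  rewrite (le_trans (leeD (smoothed_le nu b e0 d0) (lexx _)))//.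
  rewrite -addeA leeD2l// -EFinD lee_fin; lra.
have cov : `]b, +oo[%classic = \bigcup_n `](b + n.+1%:R^-1 + n.+1%:R^-1)%R,
  +oo[%classic :> set RT.
  rewrite eqEsubset; split => x /=.
    rewrite in_itv/= andbT => bx.
    have := truncnS_gt (2 / (x - b)); set n := Num.trunc _ => xn.
    exists n => //=; rewrite in_itv/= andbT -addrA -ltrBrDl.
    have -> : n.+1%:R^-1 + n.+1%:R^-1 = 2 / n.+1%:R :> R by field.
    by rewrite ltr_pdivrMr// mulrC -ltr_pdivrMr// subr_gt0.
  move=> [n _ /=]; rewrite !in_itv/= !andbT; apply: le_lt_trans.
  by rewrite -addrA lerDl addr_ge0.
have : mu `](b + n.+1%:R^-1 + n.+1%:R^-1)%R,
  +oo[%classic @[n --> \oo] --> mu `]b, +oo[%classic.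
  rewrite cov; apply: nondecreasing_cvg_mu.
  - by move=> n; exact: measurable_itv.
  - by rewrite -cov; exact: measurable_itv.
  - move=> m n mn; apply/subsetPset => x /=; rewrite !in_itv/= !andbT.
    apply: le_lt_trans; rewrite -!addrA lerD2l.
    have : n.+1%:R^-1 <= m.+1%:R^-1 :> R by rewrite lef_pV2 ?posrE// ler_nat.
    by move=> ?; apply: lerD.
move=> c; rewrite -(cvg_lim _ c)//; apply: lime_le; first exact: cvgP c.
by apply: nearW => n; apply: H; rewrite invr_gt0.
Qed.

(** Half-lines generate the Borel sets and are stable under intersection. *)
Theorem cf_unique mu nu : same_cf mu nu ->
  forall A, measurable A -> mu A = nu A.
Proof.
move=> cf A mA.
have cf' : same_cf nu mu by move=> t c; rewrite cf.
have mG : @measurable _ RT =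
  <<s (@RGenOInfty.G R) >> by exact: RGenOInfty.measurableE.
refine (@measure_unique _ R RT (@RGenOInfty.G R) (fun n =>
  `]- n%:R, +oo[%classic) mG _ _ _ mu nu _ _ A mA) => //.
- move=> _ _ [x ->] [y ->]; exists (Num.max x y).
  by apply/seteqP; split => z /=; rewrite !in_itv/= !andbT gt_max => /andP.
- by move=> n; eexists.
- apply/seteqP; split => // x _ /=; exists (Num.trunc `|x|).+1 => //=.
  rewrite in_itv/= andbT ltrNl (le_lt_trans (ler_norm _))// normrN.
  exact: truncnS_gt.
- by move=> _ [x ->]; apply/eqP; rewrite eq_le !same_cf_le.
- move=> n; rewrite (le_lt_trans (probability_le1 _ _)) ?ltry//;
    exact: measurable_itv.
Qed.

End uniqueness.

(** * Herschel's functional equation *)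

Section herschel.
Context (R : realType).

(** [L] is nonincreasing, so with [k <= n u < k + 1] both [n L(u)] and [n u
    L(1)] lie between [(k + 1) L(1)] and [k L(1)], for every [n]. *)
Lemma additive_monotone_linear (L : R -> R) :
  (forall u v, 0 <= u -> 0 <= v -> L (u + v) = L u + L v) ->
  (forall u, 0 <= u -> L u <= 0) ->
  forall u, 0 <= u -> L u = u * L 1.
Proof.
move=> LD L0 u u0.
have Lmuln n v : 0 <= v -> L (n%:R * v) = n%:R * L v.
  move=> v0; elim: n => [|n IHn].
    by rewrite !mul0r; have := LD 0 0 (lexx _) (lexx _); rewrite addr0; lra.
  by rewrite -[n.+1]addn1 !natrD !mulrDl !mul1r LD ?mulr_ge0// IHn.
have Lmono v w : 0 <= v -> v <= w -> L w <= L v.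
  move=> v0 vw; have -> : w = v + (w - v) by ring.
  by rewrite LD ?subr_ge0// gerDl L0// subr_ge0.
have key n : n%:R * `|L u - u * L 1| <= - L 1.
  have nu0 : 0 <= n%:R * u by rewrite mulr_ge0.
  set k := Num.trunc (n%:R * u).
  have k1 : k%:R <= n%:R * u by rewrite -truncn_ge_nat.
  have k2 : n%:R * u < k.+1%:R by exact: truncnS_gt.
  have Lk1 : L (n%:R * u) <= L (k%:R * 1) by rewrite mulr1; exact: Lmono.
  have Lk2 : L (k.+1%:R * 1) <= L (n%:R * u).
    by rewrite mulr1; apply: Lmono => //; exact: ltW.
  move: Lk1 Lk2; rewrite !Lmuln// => Lk1 Lk2.
  have L1 : L 1 <= 0 by exact: L0.
  rewrite -[X in X * _]normr_nat -normrM mulrBr ler_norml.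
  move: Lk2 k2; rewrite -[k.+1]addn1 natrD => Lk2 k2.
  apply/andP; split; nra.
apply/eqP; rewrite -subr_eq0 -normr_eq0 eq_le normr_ge0 andbT leNgt.
apply/negP => x0.
have := key (Num.trunc (- L 1 / `|L u - u * L 1|)).+1.
by rewrite leNgt -ltr_pdivrMr// truncnS_gt.
Qed.

Lemma polar (a b : R) : 0 <= a -> 0 <= b -> exists t,
  Num.sqrt a = Num.sqrt (a + b) * cos t /\ Num.sqrt b =
    Num.sqrt (a + b) * sin t.
Proof.
move=> a0 b0; have [ab|ab] := eqVneq (a + b) 0.
  have [-> ->] : a = 0 /\ b = 0 by split; lra.
  by exists 0; rewrite addr0 sqrtr0 !mul0r.
have ab0 : 0 < a + b by rewrite lt0r ab addr_ge0.
have q0 : 0 <= a / (a + b) by rewrite divr_ge0// ltW.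
have q1 : Num.sqrt (a / (a + b)) <= 1.
  by rewrite -[leRHS]sqrtr1 ler_sqrt// ler_pdivrMr// mul1r lerDl.
exists (acos (Num.sqrt (a / (a + b)))).
rewrite acosK ?in_itv/= ?q1 ?andbT ?(le_trans _ (sqrtr_ge0 _)) ?lerN10//.
rewrite sin_acos ?q1 ?andbT ?(le_trans _ (sqrtr_ge0 _)) ?lerN10//.
rewrite sqr_sqrtr// -!sqrtrM ?addr_ge0//; split; congr Num.sqrt; by field.
Qed.

(** For [h u = f (sqrt u)] the equation reads [h (u + v) = h u * h v]. Since [h
    u = h (u / 4) ^ 4], a zero of [h] would propagate to points tending to 0,
    where [h] tends to 1; so [ln h] makes sense. It is additive and
    nonpositive, hence linear. *)
Lemma herschel_maxwell (f : R -> R) : f 0 = 1 -> (forall x, f x <= 1) ->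
  (forall x, f (x / 2 ^+ n) @[n --> \oo] --> (1 : R)) ->
  (forall r t, f r = f (r * cos t) * f (r * sin t)) ->
  exists2 k, 0 <= k & forall x, f x = expR (- (k * x ^+ 2)).
Proof.
move=> f0 f1 fc fM; pose h u := f (Num.sqrt u).
have hD u v : 0 <= u -> 0 <= v -> h (u + v) = h u * h v.
  by move=> u0 v0; have [t [ut vt]] := polar u0 v0; rewrite /h ut vt -fM.
have h_sq u : 0 <= u -> h u = h (u / 4) ^+ 4.
  move=> u0; have u4 : 0 <= u / 4 by rewrite divr_ge0.
  rewrite {1}(_ : u = u / 4 + u / 4 + (u / 4 + u / 4)); last by field.
  by rewrite !hD ?addr_ge0//; ring.
have h_gt0 u : 0 <= u -> 0 < h u.
  move=> u0; have hu0 : 0 <= h u by rewrite h_sq// exprn_even_ge0.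
  rewrite lt0r hu0 andbT; apply/negP => /eqP hu.
  have hn n : h (u / 4 ^+ n) = 0.
    elim: n => [|n IHn]; first by rewrite expr0 divr1.
    have u4 : 0 <= u / 4 ^+ n by rewrite divr_ge0// exprn_ge0.
    move: IHn; rewrite h_sq// => /eqP; rewrite expf_eq0/= => /eqP.
    by rewrite -mulrA -invfM -exprSr.
  have hs n : f (Num.sqrt u / 2 ^+ n) = 0.
    rewrite -(hn n) /h sqrtrM// sqrtrV ?exprn_ge0//; congr (f (_ / _)).
    rewrite (_ : 4 = 2 ^+ 2)//; last by rewrite -natrX.
    by rewrite -exprM mulnC exprM sqrtr_sqr ger0_norm// exprn_ge0.
  have := fc (Num.sqrt u); under eq_fun do rewrite hs.
  move=> /cvg_lim; rewrite lim_cst// => /(_ (@Rhausdorff R)) /eqP.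
  by rewrite eq_sym oner_eq0.
pose L u := ln (h u).
have LD u v : 0 <= u -> 0 <= v -> L (u + v) = L u + L v.
  by move=> u0 v0; rewrite /L hD// lnM// posrE h_gt0.
have L0 u : 0 <= u -> L u <= 0 by move=> u0; rewrite /L ln_le0// f1.
have hE u : 0 <= u -> h u = expR (u * L 1).
  by move=> u0; rewrite -(additive_monotone_linear LD L0 u0) lnK// posrE h_gt0.
exists (- L 1); first by rewrite oppr_ge0 L0.
move=> x; have -> : f x = h (x ^+ 2).
  have feven : f (- x) = f x.
    by rewrite [RHS](fM x pi) cospi sinpi mulrN1 mulr0 f0 mulr1.
  by rewrite /h sqrtr_sqr; case: (ger0P x) => _; rewrite ?feven.
by rewrite hE ?sqr_ge0// mulrC mulNr opprK.
Qed.

End herschel.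

(** * Moments of the coefficients of a bounded field *)

Section moments.
Context d (X : measurableType d) (R : realType) (P : probability X R).

(** The partial sums are polynomials in [Y] and [Z], dominated by [expR K].
    This is applied to [cos] and [sin]: a bounded variable has its law
    determined by its moments. *)
Lemma same_moments_power_series (a : nat -> R) (F Y Z : _ -> R) (K : R) :
  (forall n, `|a n| <= n`!%:R^-1) ->
  (forall x : R, \sum_(0 <= k < n) a k * x ^+ k @[n --> \oo] --> F x) ->
  measurable_fun setT F ->
  measurable_fun setT Y -> measurable_fun setT Z ->
  (forall w, `|Y w| <= K) -> (forall w, `|Z w| <= K) ->
  (forall m, \int[P]_w Y w ^+ m = \int[P]_w Z w ^+ m) ->
  \int[P]_w F (Y w) = \int[P]_w F (Z w).
Proof.
move=> a1 aF mF mY mZ YK ZK YZ.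
pose s n (x : R) := \sum_(0 <= k < n) a k * x ^+ k.
have ms n : measurable_fun setT (s n).
  elim: n => [|n IHn].
    by rewrite (_ : s 0%N = cst 0)//; apply/funext => x; rewrite /s big_geq.
  rewrite (_ : s n.+1 = fun x => s n x + a n * x ^+ n).
    by apply: measurable_funD => //; apply: measurable_funM => //;
      exact: measurable_funX.
  by apply/funext => x; rewrite /s big_nat_recr.
have K0 : 0 <= K by exact: le_trans (YK point).
have sK n x : `|x| <= K -> `|s n x| <= expR K.
  move=> xK; rewrite /expR.
  apply: (@le_trans _ _ (series (exp_coeff K) n)); last first.
    apply: nondecreasing_cvgn_le; last exact: is_cvg_series_exp_coeff.
    by apply: nondecreasing_series => k _ _; exact: exp_coeff_ge0.
  rewrite (le_trans (ler_norm_sum _ _ _))//; apply: ler_sum => k _.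
  rewrite normrM normrX mulrC; apply: ler_pM => //; rewrite ?exprn_ge0//.
  by rewrite lerXn2r ?nnegrE.
have intY (Y' : X -> R) n : measurable_fun setT Y' ->
  (forall w, `|Y' w| <= K) ->
    P.-integrable setT (EFin \o (fun w => Y' w ^+ n)).
  move=> mY' Y'K; apply: (@integrable_bounded _ _ _ _ _ (K ^+ n)).
    exact: measurable_funX.
  by move=> w; rewrite normrX lerXn2r ?nnegrE.
have Es (Y' : X -> R) n : measurable_fun setT Y' -> (forall w, `|Y' w| <= K) ->
    \int[P]_w s n (Y' w) = \sum_(0 <= k < n) a k * \int[P]_w (Y' w ^+ k).
  move=> mY' Y'K; elim: n => [|n IHn].
    rewrite big_geq// -[RHS](mean_cst P 0); apply: eq_Rintegral => w _.
    by rewrite /s big_geq.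
  rewrite big_nat_recr//= -IHn -RintegralZl//; last exact: intY.
  rewrite -RintegralD//.
  - by apply: eq_Rintegral => w _; rewrite /s big_nat_recr.
  - apply: (@integrable_bounded _ _ _ _ _ (expR K));
      first exact: measurableT_comp.
    by move=> w; exact: sK.
  - exact: (integrableZl measurableT (a n) (intY _ n mY' Y'K)).
have lim (Y' : X -> R) : measurable_fun setT Y' -> (forall w, `|Y' w| <= K) ->
    \int[P]_w s n (Y' w) @[n --> \oo] --> \int[P]_w F (Y' w).
  move=> mY' Y'K; apply: (@dominated_mean _ _ _ P _ _ (expR K)).
  - by move=> n; exact: measurableT_comp.
  - exact: measurableT_comp.
  - by move=> n w; exact: sK.
  - by apply: aeW => w; exact: aF.
have := lim _ mY YK.
have -> : (fun n => \int[P]_w s n (Y w)) = (fun n => \int[P]_w s n (Z w)).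
  apply/funext => n; rewrite !Es//; apply: eq_bigr => k _; by rewrite YZ.
by move=> /cvg_unique /(_ (lim _ mZ ZK)); apply; exact: Rhausdorff.
Qed.

Lemma same_moments_cos (Y Z : X -> R) (K c : R) :
  measurable_fun setT Y -> measurable_fun setT Z ->
  (forall w, `|Y w| <= K) -> (forall w, `|Z w| <= K) ->
  (forall m, \int[P]_w Y w ^+ m = \int[P]_w Z w ^+ m) ->
  \int[P]_w cos (Y w + c) = \int[P]_w cos (Z w + c).
Proof.
move=> mY mZ YK ZK YZ.
have mc : measurable_fun setT (@cos R).
  by apply: continuous_measurable_fun; exact: continuous_cos.
have ms : measurable_fun setT (@sin R).
  by apply: continuous_measurable_fun; exact: continuous_sin.
have coef (b : bool) n m : `|b%:R * (-1) ^+ n * m`!%:R^-1| <= m`!%:R^-1 :> R.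
  rewrite !normrM normrX normrN1 expr1n mulr1 normfV !normr_nat.
  by apply: ler_piMl; rewrite ?invr_ge0//; case: b.
have Ec : \int[P]_w cos (Y w) = \int[P]_w cos (Z w).
  apply: (@same_moments_power_series
    (fun n => (~~ odd n)%:R * (-1) ^+ n./2 * n`!%:R^-1) (@cos R) Y Z K) => //.
  move=> x; have := @is_cvg_series_cos_coeff R x.
  have -> : cos x = limn (series (cos_coeff x)) by rewrite unlock.
  by rewrite cos_coeffE.
have Es : \int[P]_w sin (Y w) = \int[P]_w sin (Z w).
  apply: (@same_moments_power_series
    (fun n => (odd n)%:R * (-1) ^+ n.-1./2 * n`!%:R^-1) (@sin R) Y Z K) => //.
  move=> x; have := @is_cvg_series_sin_coeff R x.
  have -> : sin x = limn (series (sin_coeff x)) by rewrite unlock.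
  by rewrite sin_coeffE.
have E (Y' : X -> R) : measurable_fun setT Y' ->
    \int[P]_w cos (Y' w + c) =
      cos c * \int[P]_w cos (Y' w) - sin c * \int[P]_w sin (Y' w).
  move=> mY'.
  have i1 : P.-integrable setT (EFin \o (fun w => cos (Y' w))).
    apply: (@integrable_bounded _ _ _ _ _ 1); first exact: measurableT_comp.
    by move=> w; exact: cos_max.
  have i2 : P.-integrable setT (EFin \o (fun w => sin (Y' w))).
    apply: (@integrable_bounded _ _ _ _ _ 1); first exact: measurableT_comp.
    by move=> w; exact: sin_max.
  rewrite -!RintegralZl// -RintegralB//.
  - by apply: eq_Rintegral => w _; rewrite cosD mulrC [in X in _ - X]mulrC.
  - exact: (integrableZl measurableT (cos c) i1).
  - exact: (integrableZl measurableT (sin c) i2).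
by rewrite !E// Ec Es.
Qed.

End moments.

Section bounded_fields.
Context d (X : measurableType d) d' (W : measurableType d') (R : realType).
Variables (sigma : probability X R) (P : probability W R).

Section one_field.
Variables (S : X -> W -> R) (f : X -> R) (M C : R).
Hypothesis mS : measurable_fun setT (fun z : X * W => S z.1 z.2).
Hypothesis SM : forall x w, `|S x w| <= M.
Hypothesis mf : measurable_fun setT f.
Hypothesis fC : forall x, `|f x| <= C.

Definition field_mean (S : X -> W -> R) (f : X -> R) (w : W) : R :=
  \int[sigma]_x (S x w * f x).

Let mSf : measurable_fun setT (fun z : X * W => S z.1 z.2 * f z.1).
Proof. by apply: measurable_funM => //; exact: measurableT_comp. Qed.

Let M0 : 0 <= M. Proof. exact: le_trans (SM point point). Qed.
Let C0 : 0 <= C. Proof. exact: le_trans (fC point). Qed.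

Let SfMC z : `|S z.1 z.2 * f z.1| <= M * C.
Proof. by rewrite normrM ler_pM. Qed.

Lemma measurable_field_mean : measurable_fun setT (field_mean S f).
Proof. exact: (measurable_mean2 sigma P mSf SfMC). Qed.

Lemma field_mean_bound w : `|field_mean S f w| <= M * C.
Proof.
apply: le_norm_mean; last by move=> x; exact: (SfMC (x, w)).
exact: (measurable_fun_pair1 _ mSf).
Qed.

Lemma measurable_section y : measurable_fun setT (S y).
Proof. exact: (measurable_fun_pair2 y mS). Qed.

Lemma measurable_prod_field (ys : seq X) :
  measurable_fun setT (fun w => \prod_(y <- ys) S y w).
Proof.
elim: ys => [|y ys IHys].
  by rewrite (_ : (fun _ => _) = cst 1)//; apply/funext => w; rewrite big_nil.
rewrite (_ : (fun _ => _) = fun w => S y w * \prod_(y <- ys) S y w).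
  by apply: measurable_funM => //; exact: measurable_section.
by apply/funext => w; rewrite big_cons.
Qed.

Lemma prod_field_bound (ys : seq X) w :
  `|\prod_(y <- ys) S y w| <= M ^+ size ys.
Proof.
elim: ys => [|y ys IHys]; first by rewrite big_nil normr1.
by rewrite big_cons normrM exprS ler_pM.
Qed.

(** Exchanging the two integrals turns one of the factors [field_mean S f w]
    into the value of the field at one more point [x], over which the result is
    averaged. *)
Lemma mixed_moment_rec (ys : seq X) m :
  \int[P]_w (\prod_(y <- ys) S y w * field_mean S f w ^+ m.+1) =
  \int[sigma]_x (f x *
    \int[P]_w (\prod_(y <- x :: ys) S y w * field_mean S f w ^+ m)).
Proof.
pose g w := \prod_(y <- ys) S y w * field_mean S f w ^+ m.
have mg : measurable_fun setT g.
  apply: measurable_funM; first exact: measurable_prod_field.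
  by apply: measurable_funX; exact: measurable_field_mean.
pose B := M ^+ size ys * (M * C) ^+ m.
have gB w : `|g w| <= B.
  rewrite normrM ler_pM// ?prod_field_bound// normrX lerXn2r ?nnegrE
    ?mulr_ge0//.
  exact: field_mean_bound.
have B0 : 0 <= B by exact: le_trans (gB point).
pose h (z : X * W) := g z.2 * (S z.1 z.2 * f z.1).
have mh : measurable_fun setT h.
  by apply: measurable_funM => //; exact: measurableT_comp.
have hB z : `|h z| <= B * (M * C) by rewrite normrM ler_pM.
transitivity (\int[P]_w \int[sigma]_x h (x, w)).
  apply: eq_Rintegral => w _; rewrite exprSr mulrA -/(g w) -RintegralZl//.
  apply: integrable_bounded; first exact: (measurable_fun_pair1 w mSf).
  by move=> x; exact: (SfMC (x, w)).
rewrite -(Fubini_mean sigma P mh hB); apply: eq_Rintegral => x _.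
rewrite -RintegralZl//.
  by apply: eq_Rintegral => w _; rewrite /h/g/= big_cons; ring.
apply: (@integrable_bounded _ _ _ _ _ (M * B)).
  under eq_fun do rewrite big_cons -mulrA.
  apply: measurable_funM => //; exact: measurable_section.
by move=> w; rewrite big_cons -mulrA normrM; apply: ler_pM => //; exact: gB.
Qed.

End one_field.

(** The recursion goes through arbitrary lists of points, although only the
    empty list is of interest in the end. *)
Lemma same_mixed_moments (S S' : X -> W -> R) (f : X -> R) (M C : R) :
  measurable_fun setT (fun z : X * W => S z.1 z.2) ->
  measurable_fun setT (fun z : X * W => S' z.1 z.2) ->
  (forall x w, `|S x w| <= M) -> (forall x w, `|S' x w| <= M) ->
  measurable_fun setT f -> (forall x, `|f x| <= C) ->
  (forall ys, \int[P]_w \prod_(y <- ys) S y w =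
    \int[P]_w \prod_(y <- ys) S' y w) ->
  forall m ys, \int[P]_w (\prod_(y <- ys) S y w * field_mean S f w ^+ m) =
               \int[P]_w (\prod_(y <- ys) S' y w * field_mean S' f w ^+ m).
Proof.
move=> mS mS' SM S'M mf fC SS'; elim => [|m IHm] ys.
  by under eq_Rintegral do rewrite mulr1;
    under [RHS]eq_Rintegral do rewrite mulr1.
rewrite (mixed_moment_rec mS SM mf fC) (mixed_moment_rec mS' S'M mf fC).
by apply: eq_Rintegral => x _; rewrite IHm.
Qed.

(** Fields with the same moments at finitely many points have coefficients with
    the same law. Joint measurability alone suffices for this, because the
    integral over [X] is never approximated by values of the field: its moments
    are averages of moments of such values. *)
Lemma same_law_field_mean (S S' : X -> W -> R) (f : X -> R) (M C c : R) :
  measurable_fun setT (fun z : X * W => S z.1 z.2) ->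
  measurable_fun setT (fun z : X * W => S' z.1 z.2) ->
  (forall x w, `|S x w| <= M) -> (forall x w, `|S' x w| <= M) ->
  measurable_fun setT f -> (forall x, `|f x| <= C) ->
  (forall ys, \int[P]_w \prod_(y <- ys) S y w =
    \int[P]_w \prod_(y <- ys) S' y w) ->
  \int[P]_w cos (field_mean S f w + c) = \int[P]_w cos (field_mean S' f w + c).
Proof.
move=> mS mS' SM S'M mf fC SS'.
apply: (@same_moments_cos _ _ _ _ _ _ (M * C)).
- exact: measurable_field_mean mS SM mf fC.
- exact: measurable_field_mean mS' S'M mf fC.
- by move=> w; exact: field_mean_bound.
- by move=> w; exact: field_mean_bound.
move=> m; have := same_mixed_moments mS mS' SM S'M mf fC SS' m [::].
under eq_Rintegral do rewrite big_nil mul1r.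
by under [X in _ = X -> _]eq_Rintegral do rewrite big_nil mul1r.
Qed.

End bounded_fields.

(** * Rotations in a plane *)

Section rotations.
Context (R : realType) (n : nat).
Implicit Types x y p q : 'cV[R]_n.+1.

Definition dot x y : R := \sum_i x i 0 * y i 0.

Lemma dotE x y : (x^T *m y) 0 0 = dot x y.
Proof. by rewrite mxE; apply: eq_bigr => i _; rewrite mxE. Qed.

Lemma mul_tr_dot x y : x^T *m y = (dot x y)%:M.
Proof. by rewrite [LHS]mx11_scalar dotE. Qed.

Lemma dotC x y : dot x y = dot y x.
Proof. by apply: eq_bigr => i _; rewrite mulrC. Qed.

Lemma dotDl x y z : dot (x + y) z = dot x z + dot y z.
Proof. by rewrite /dot -big_split; apply: eq_bigr => i _;
  rewrite mxE mulrDl. Qed.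

Lemma dotZl a x y : dot (a *: x) y = a * dot x y.
Proof. by rewrite /dot mulr_sumr; apply: eq_bigr => i _; rewrite mxE mulrA. Qed.

Lemma dotDr x y z : dot x (y + z) = dot x y + dot x z.
Proof. by rewrite !(dotC x) dotDl. Qed.

Lemma dotZr a x y : dot x (a *: y) = a * dot x y.
Proof. by rewrite !(dotC x) dotZl. Qed.

Lemma dot_eq0 x : (dot x x == 0) = (x == 0).
Proof.
apply/eqP/eqP => [x0|->]; last by rewrite /dot big1// => i _; rewrite mxE mul0r.
apply/colP => i; rewrite mxE; apply/eqP.
have /psumr_eq0P/(_ x0 i isT) : forall i, true -> 0 <= x i 0 * x i 0.
  by move=> j _; rewrite -expr2 sqr_ge0.
by move/eqP; rewrite mulf_eq0 orbb.
Qed.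

Lemma dot_ge0 x : 0 <= dot x x.
Proof. by apply: sumr_ge0 => i _; rewrite -expr2 sqr_ge0. Qed.

Lemma dot_SO (g : SO R n) x y : dot (sval g *m x) (sval g *m y) = dot x y.
Proof.
case: g => g /= /andP[/eqP gg _].
by rewrite -!dotE trmx_mul mulmxA -(mulmxA x^T) gg mulmx1.
Qed.

Definition plane_rotation (t : R) : 'M[R]_(1 + 1) :=
  block_mx (cos t)%:M (- sin t)%:M (sin t)%:M (cos t)%:M.

Lemma plane_rotationD s t :
  plane_rotation (s + t) = plane_rotation s *m plane_rotation t.
Proof.
rewrite /plane_rotation mulmx_block -!scalar_mxM -!raddfD/= cosD sinD.
congr block_mx; congr (_%:M); ring.
Qed.

Lemma plane_rotation0 : plane_rotation 0 = 1%:M.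
Proof. by rewrite /plane_rotation cos0 sin0 oppr0 raddf0 -scalar_mx_block. Qed.

Lemma tr_plane_rotation t : (plane_rotation t)^T = plane_rotation (- t).
Proof. by rewrite /plane_rotation tr_block_mx !tr_scalar_mx cosN sinN opprK.
  Qed.

Section rotation_in_plane.
Variables p q : 'cV[R]_n.+1.
Hypotheses (pp : dot p p = 1) (qq : dot q q = 1) (pq : dot p q = 0).

Let B : 'M[R]_(n.+1, 1 + 1) := row_mx p q.

Let BB : B^T *m B = 1%:M.
Proof.
rewrite /B tr_row_mx mul_col_row !mul_tr_dot pp qq pq (dotC q p) pq.
by rewrite raddf0 -scalar_mx_block.
Qed.

Let G (M : 'M[R]_(1 + 1)) : 'M[R]_n.+1 := 1%:M + B *m (M - 1%:M) *m B^T.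

(* [G M] acts by [M] on the plane and trivially on its orthogonal complement.
   *)
Let GM M N : G M *m G N = G (M *m N).
Proof.
have key (D E : 'M[R]_(1 + 1)) :
    (1%:M + B *m D *m B^T) *m (1%:M + B *m E *m B^T) =
    1%:M + B *m (D + E + D *m E) *m B^T.
  rewrite mulmxDl mul1mx mulmxDr mulmx1 -!addrA; congr (_ + _).
  rewrite !mulmxA -(mulmxA _ B^T B) BB mulmx1 !mulmxDr !mulmxDl !mulmxA.
  by rewrite addrA (addrC (B *m E *m B^T)) -!addrA.
rewrite /G key; congr (_ + _ *m _ *m _).
rewrite mulmxBl mulmxBr mul1mx mulmx1; move: (M *m N) => Q.
by apply/matrixP => i j; rewrite !mxE; ring.
Qed.

Let G1 : G 1%:M = 1%:M.
Proof. by rewrite /G subrr mulmx0 mul0mx addr0. Qed.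

Let GT M : (G M)^T = G M^T.
Proof.
by rewrite /G linearD/= tr_scalar_mx !trmx_mul trmxK mulmxA linearB/=
  tr_scalar_mx.
Qed.

Let GTG t : (G (plane_rotation t))^T *m G (plane_rotation t) = 1%:M.
Proof. by rewrite GT tr_plane_rotation GM -plane_rotationD addNr
  plane_rotation0 G1. Qed.

(* A rotation is the square of the rotation of half its angle, and the
   determinant of an orthogonal matrix is a square root of 1. *)
Let detG t : \det (G (plane_rotation t)) = 1.
Proof.
have -> : t = t / 2 + t / 2 by field.
rewrite plane_rotationD -GM det_mulmx.
have := congr1 determinant (GTG (t / 2)).
by rewrite det_mulmx det_tr det1.
Qed.

(** The rotation of angle [t] in the oriented plane spanned by [p], [q]. *)
Lemma rotation_in_plane t : exists g : SO R n, forall x, sval g *m x =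
  x + ((cos t - 1) * dot p x - sin t * dot q x) *: p
    + (sin t * dot p x + (cos t - 1) * dot q x) *: q.
Proof.
have gP : ((G (plane_rotation t))^T *m G (plane_rotation t) == 1%:M) &&
    (\det (G (plane_rotation t)) == 1) by rewrite GTG detG !eqxx.
exists (exist (fun h : 'M[R]_n.+1 => (h^T *m h == 1%:M) && (\det h == 1)) _ gP).
move=> x /=; rewrite /G mulmxDl mul1mx -addrA; congr (_ + _).
rewrite -!mulmxA {2}/B tr_row_mx mul_col_mx !mul_tr_dot.
rewrite /plane_rotation [X in _ - X]scalar_mx_block opp_block_mx add_block_mx.
rewrite oppr0 !addr0 -!raddfB/= mul_block_col -!scalar_mxM -!raddfD/=.
rewrite /B mul_row_col !mul_mx_scalar; congr (_ *: _ + _ *: _); ring.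
Qed.

End rotation_in_plane.

End rotations.

(** * Linear forms on the sphere *)

Section sphere_measurability.
Context (R : realType) (n : nat).
Implicit Types (x : sphere R n).

Lemma continuous_sum_seq (T : topologicalType) (I : Type) (r : seq I)
    (F : I -> T -> R) : (forall i, continuous (F i)) ->
  continuous (fun t => \sum_(i <- r) F i t).
Proof.
move=> cF; elim: r => [|i r IHr].
  rewrite (_ : (fun _ => _) = cst 0); first by move=> t; exact: cvg_cst.
  by apply/funext => t; rewrite big_nil.
rewrite (_ : (fun _ => _) = fun t => F i t + \sum_(i <- r) F i t).
  by move=> t; apply: cvgD; [exact: cF|exact: IHr].
by apply/funext => t; rewrite big_cons.
Qed.

Lemma continuous_mulmx (g : 'M[R]_n.+1) :
  continuous (fun x : 'cV[R]_n.+1 => g *m x : 'cV[R]_n.+1).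
Proof.
move=> x A [P Px sPA].
have cg i j : \forall y \near x, P i j ((g *m y) i j).
  have : (fun y : 'cV[R]_n.+1 => (g *m y) i j) y @[y --> x] --> (g *m x) i j.
    under eq_fun do rewrite mxE.
    rewrite mxE; apply: continuous_sum_seq => k y.
    apply: (@continuous_comp _ _ _ (fun y : 'cV[R]_n.+1 => y k j)
      (fun z : R => g i k * z)); first exact: coord_continuous.
    exact: mulrl_continuous.
  by move=> c; have := c _ (Px i j).
have H : \forall y \near x, forall i j, P i j ((g *m y) i j).
  have FF := nbhs_filter x.
  apply: (@filter_forall _ _ (fun i => [set y | forall j, P i j ((g *m y) i j)])
    (nbhs x) FF) => i.
  by apply: (@filter_forall _ _ (fun j => [set y | P i j ((g *m y) i j)])
    (nbhs x) FF) => j; exact: cg.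
have FF := nbhs_filter x.
by apply: (@filterS _ (nbhs x) FF _ _ _ H) => y Py; apply: sPA.
Qed.

Lemma continuous_sval : continuous (fun x : sphere R n => sval x : 'cV[R]_n.+1).
Proof. exact: initial_continuous. Qed.

Lemma measurable_open_sphere (U : set (sphere R n)) : open U -> measurable U.
Proof. by move=> oU; exact: sub_sigma_algebra. Qed.

Lemma continuous_measurable_sphere (f : sphere R n -> R) :
  continuous f -> measurable_fun setT f.
Proof.
move=> cf.
apply: (@measurability _ _ _ _ setT f (@RGenOpens.G R)).
  exact: RGenOpens.measurableE.
move=> _ [_ [a [b ->]] <-]; rewrite setTI; apply: measurable_open_sphere.
by apply: open_comp; [move=> x _; exact: cf|exact: itv_open].
Qed.

Lemma measurable_coord (i : 'I_n.+1) :
  measurable_fun setT (fun x : sphere R n => sval x i 0).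
Proof.
apply: continuous_measurable_sphere => x.
apply: (@continuous_comp _ _ _ (fun x : sphere R n => sval x : 'cV[R]_n.+1)
  (fun y : 'cV[R]_n.+1 => y i 0)); first exact: continuous_sval.
exact: coord_continuous.
Qed.

Lemma measurable_SO_act (g : SO R n) : measurable_fun setT (SO_act g).
Proof.
have cg : continuous (SO_act g).
  apply: continuous_comp_initial => x.
  apply: (@continuous_comp _ _ _ (fun x : sphere R n => sval x : 'cV[R]_n.+1)
    (fun y : 'cV[R]_n.+1 => sval g *m y)); first exact: continuous_sval.
  exact: continuous_mulmx.
apply: (@measurability _ _ _ _ setT (SO_act g) (@open (sphere R n))) => //.
move=> _ [U oU <-]; rewrite setTI; apply: measurable_open_sphere.
by apply: open_comp => // x _; exact: cg.
Qed.

Definition linear_form (u : 'cV[R]_n.+1) (x : sphere R n) : R := dot u (sval x).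

Lemma measurable_linear_form u : measurable_fun setT (linear_form u).
Proof.
apply: measurable_sum => i; apply: measurable_funM => //.
exact: measurable_coord.
Qed.

Lemma dot_sphere x : dot (sval x) (sval x) = 1.
Proof.
have : sphere_set R n (sval x) by apply: set_mem; exact: valP.
by apply: etrans; apply: eq_bigr => i _; rewrite expr2.
Qed.

Lemma linear_form_SO g u x :
  linear_form (sval g *m u) (SO_act g x) = linear_form u x.
Proof. exact: dot_SO. Qed.

Lemma linear_form_bound u x : `|linear_form u x| <= \sum_i `|u i 0|.
Proof.
rewrite (le_trans (ler_norm_sum _ _ _))//; apply: ler_sum => i _.
rewrite normrM ler_piMr// -[leRHS]sqrtr1 -sqrtr_sqr ler_sqrt//.
rewrite -(dot_sphere x) expr2 [leRHS](bigD1 i)//= lerDl.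
by apply: sumr_ge0 => j _; rewrite -expr2 sqr_ge0.
Qed.

Lemma linear_formD u v x : linear_form (u + v) x =
  linear_form u x + linear_form v x.
Proof. exact: dotDl. Qed.

Lemma linear_formZ a u x : linear_form (a *: u) x = a * linear_form u x.
Proof. exact: dotZl. Qed.

Section invariant_measure.
Variable sigma : probability (sphere R n) R.
Hypothesis hsigma : rotation_invariant sigma.

Lemma mean_SO_act (g : SO R n) (f : sphere R n -> R) (M : R) :
  measurable_fun setT f -> (forall x, `|f x| <= M) ->
  \int[sigma]_x f (SO_act g x) = \int[sigma]_x f x.
Proof.
move=> mf fM.
pose h : {RV sigma >-> sphere R n} := HB.pack (SO_act g)
  (isMeasurableFun.Build _ _ _ _ _ (measurable_SO_act g)).
rewrite -(mean_distribution h mf fM); congr fine.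
by apply: eq_measure_integral => A mA _; exact: hsigma.
Qed.

End invariant_measure.

End sphere_measurability.

Section sphere_moments.
Context (R : realType) (n : nat).
Variable sigma : probability (sphere R n) R.
Hypothesis hsigma : rotation_invariant sigma.
Hypothesis n2 : (2 <= n)%N.
Implicit Types (u v : 'cV[R]_n.+1) (x : sphere R n) (i j k : 'I_n.+1).

Lemma third_index i j : exists l : 'I_n.+1, (l != i) && (l != j).
Proof.
have : (0 < #|~: [set i; j]|)%N.
  rewrite cardsCs finset.setCK card_ord cards2; by case: (i != j);
    rewrite subn_gt0 ltnS ?(ltnW n2).
by move=> /card_gt0P[l]; rewrite !inE negb_or => lij; exists l.
Qed.

Definition basis_vec i : 'cV[R]_n.+1 := delta_mx i 0.

Lemma dot_basis_vec i u : dot (basis_vec i) u = u i 0.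
Proof.
rewrite /dot (bigD1 i)//= big1 ?addr0 ?mxE ?eqxx ?mul1r// => j /negPf ji.
by rewrite mxE ji mul0r.
Qed.

Lemma basis_vecE i j : basis_vec i j 0 = (i == j)%:R.
Proof. by rewrite mxE andbT eq_sym. Qed.

Let rotation_basis i j t : i != j -> exists g : SO R n, forall u,
  sval g *m u = u + ((cos t - 1) * u i 0 - sin t * u j 0) *: basis_vec i
                  + (sin t * u i 0 + (cos t - 1) * u j 0) *: basis_vec j.
Proof.
move=> ij; have [||| g gE] := @rotation_in_plane R n (basis_vec i) (basis_vec
  j) _ _ _ t.
- by rewrite dot_basis_vec basis_vecE eqxx.
- by rewrite dot_basis_vec basis_vecE eqxx.
- by rewrite dot_basis_vec basis_vecE eq_sym (negPf ij).
by exists g => u; rewrite gE !dot_basis_vec.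
Qed.

(** The half-turn in the plane of [i] and [j] flips these two coordinates. *)
Lemma half_turn i j : i != j -> exists g : SO R n, forall u,
  sval g *m u = u - (2 * u i 0) *: basis_vec i - (2 * u j 0) *: basis_vec j.
Proof.
move=> ij; have [g gE] := rotation_basis pi ij; exists g => u.
by rewrite gE cospi sinpi; apply/colP => k; rewrite !mxE; ring.
Qed.

Lemma quarter_turn i j : i != j -> exists g : SO R n, forall u,
  sval g *m u = u - (u i 0 + u j 0) *: basis_vec i + (u i 0 - u j 0) *:
    basis_vec j.
Proof.
move=> ij; have [g gE] := rotation_basis (pi / 2) ij; exists g => u.
by rewrite gE cos_pihalf sin_pihalf; apply/colP => k; rewrite !mxE; ring.
Qed.

Let coord_bound i x : `|sval x i 0| <= 1.
Proof.
rewrite -[leRHS]sqrtr1 -sqrtr_sqr ler_sqrt// -(dot_sphere x) expr2 /dot.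
rewrite [leRHS](bigD1 i)//= lerDl.
by apply: sumr_ge0 => j _; rewrite -expr2 sqr_ge0.
Qed.

Let prod_bound i j x : `|sval x i 0 * sval x j 0| <= 1.
Proof. by rewrite normrM mulr_ile1. Qed.

Let measurable_prod i j :
  measurable_fun setT (fun x : sphere R n => sval x i 0 * sval x j 0).
Proof. by apply: measurable_funM; exact: measurable_coord. Qed.

Lemma mean_coord i : \int[sigma]_x sval x i 0 = 0.
Proof.
have [j] := third_index i i; rewrite andbb => ji.
have ij : i != j by rewrite eq_sym.
have [g gE] := half_turn ij.
have := mean_SO_act hsigma g (@measurable_coord R n i) (coord_bound i).
have -> : \int[sigma]_x sval (SO_act g x) i 0 = \int[sigma]_x (-1 * sval x i 0).
  apply: eq_Rintegral => x _ /=; rewrite gE !mxE !eqxx (negPf ij)/=; ring.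
rewrite RintegralZl//; first by move=> h; lra.
exact: (integrable_bounded sigma (@measurable_coord R n i) (coord_bound i)).
Qed.

(* Flip the coordinate [i] together with a third one, so that [j] is fixed. *)
Let mean_offdiag i j : i != j -> \int[sigma]_x (sval x i 0 * sval x j 0) = 0.
Proof.
move=> ij; have [l /andP[li lj]] := third_index i j.
have il : i != l by rewrite eq_sym.
have [g gE] := half_turn il.
have := mean_SO_act hsigma g (measurable_prod i j) (prod_bound i j).
have -> : \int[sigma]_x (sval (SO_act g x) i 0 * sval (SO_act g x) j 0) =
          \int[sigma]_x (-1 * (sval x i 0 * sval x j 0)).
  apply: eq_Rintegral => x _ /=; rewrite gE !mxE !eqxx (negPf il).
  rewrite (eq_sym j i) (negPf ij) (eq_sym j l) (negPf lj)/=; ring.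
rewrite RintegralZl//; first by move=> h; lra.
exact: (integrable_bounded sigma (measurable_prod i j) (prod_bound i j)).
Qed.

Let mean_diag_eq i j :
  \int[sigma]_x (sval x i 0 * sval x i 0) =
    \int[sigma]_x (sval x j 0 * sval x j 0).
Proof.
have [->//|ij] := eqVneq i j; have [g gE] := quarter_turn ij.
rewrite -(mean_SO_act hsigma g (measurable_prod j j) (prod_bound j j)).
apply: eq_Rintegral => x _ /=;
  rewrite gE !mxE !eqxx (eq_sym j i) (negPf ij)/=; ring.
Qed.

Let mean_sum (I : finType) (F : I -> sphere R n -> R) (M : R) :
  (forall p, measurable_fun setT (F p)) -> (forall p x, `|F p x| <= M) ->
  \int[sigma]_x (\sum_p F p x) = \sum_p \int[sigma]_x F p x.
Proof.
move=> mF FM; have iF (p : I) := integrable_bounded sigma (mF p) (FM p).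
rewrite /Rintegral sum_fine; last first.
  by move=> p _; apply: integrable_fin_num => //; exact: iF.
rewrite -(integral_sum measurableT iF); congr fine.
by apply: eq_integral => x _; rewrite sumEFin.
Qed.

Let mean_diag i : \int[sigma]_x (sval x i 0 * sval x i 0) = n.+1%:R^-1.
Proof.
have : \sum_j \int[sigma]_x (sval x j 0 * sval x j 0) = 1.
  rewrite -(mean_sum (fun j => measurable_prod j j) (fun j => prod_bound j j)).
  rewrite -[RHS](mean_cst sigma 1); apply: eq_Rintegral => x _.
  exact: dot_sphere.
rewrite (eq_bigr (fun=> \int[sigma]_x (sval x i 0 * sval x i 0))).
  rewrite sumr_const card_ord => h.
  by apply: (mulIf (x := n.+1%:R));
    rewrite ?pnatr_eq0// mulr_natr h mulVf// pnatr_eq0.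
by move=> j _; exact: mean_diag_eq.
Qed.

(** Half-turns kill the off-diagonal second moments of the coordinates and
    quarter-turns make the diagonal ones equal; these add up to 1 on the
    sphere. *)
Lemma mean_linear_form2 u v :
  \int[sigma]_x (linear_form u x * linear_form v x) = dot u v / n.+1%:R.
Proof.
have E x : linear_form u x * linear_form v x =
    \sum_(p : 'I_n.+1 * 'I_n.+1) (u p.1 0 * v p.2 0) * (sval x p.1 0 * sval x
      p.2 0).
  rewrite /linear_form /dot big_distrlr pair_big/=.
  by apply: eq_bigr => p _; ring.
under eq_Rintegral do rewrite E.
pose M := \sum_(p : 'I_n.+1 * 'I_n.+1) `|u p.1 0 * v p.2 0|.
rewrite (@mean_sum _ (fun p x =>
  (u p.1 0 * v p.2 0) * (sval x p.1 0 * sval x p.2 0)) M); first last.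
- move=> p x; rewrite normrM (@le_trans _ _ `|u p.1 0 * v p.2 0|)//.
    by rewrite ler_piMr.
  by rewrite /M (bigD1 p)//= lerDl sumr_ge0.
- by move=> p; apply: measurable_funM.
have E2 (p : 'I_n.+1 * 'I_n.+1) :
    \int[sigma]_x (u p.1 0 * v p.2 0 * (sval x p.1 0 * sval x p.2 0)) =
    if p.1 == p.2 then u p.1 0 * v p.2 0 / n.+1%:R else 0.
  rewrite RintegralZl//; last first.
    exact: (integrable_bounded sigma (measurable_prod _ _) (prod_bound _ _)).
  by case: eqVneq => [->|pp]; rewrite ?mean_diag// mean_offdiag// mulr0.
rewrite (eq_bigr _ (fun p _ => E2 p)).
rewrite -(pair_bigA _ (fun i j =>
  if i == j then u i 0 * v j 0 / n.+1%:R else 0))/=.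
rewrite /dot mulr_suml; apply: eq_bigr => i _.
rewrite (bigD1 i)//= eqxx big1 ?addr0// => j /negPf ji.
by rewrite eq_sym ji.
Qed.

End sphere_moments.

(** * The smallest nonconstant module *)

Import complex.
Local Open Scope complex_scope.

Section complex_forms.
Context (R : realType) (n : nat).
Variable sigma : probability (sphere R n) R.
Hypothesis hsigma : rotation_invariant sigma.
Hypothesis n2 : (2 <= n)%N.
Implicit Types (a b u v : 'cV[R]_n.+1) (x : sphere R n) (i j k : 'I_n.+1).
Implicit Types (f g : sphere R n -> R[i]).

(** The linear form of the complex vector [a + i b]. *)
Definition complex_form a b x : R[i] := linear_form a x +i* linear_form b x.

(** Linear forms are bounded, so measurability suffices for square
    integrability. *)
Definition linear_forms : set (sphere R n -> R[i]) := [set f |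
  [/\ measurable_fun setT (fun x => Re (f x) : R),
      measurable_fun setT (fun x => Im (f x) : R) &
      exists a b, eqL2 sigma f (complex_form a b)]].

Lemma eqL2_refl f : eqL2 sigma f f. Proof. exact: aeW. Qed.

Lemma eqL2_sym f g : eqL2 sigma f g -> eqL2 sigma g f.
Proof. by apply: filterS => x ->. Qed.

Lemma eqL2_trans f g h : eqL2 sigma f g -> eqL2 sigma g h -> eqL2 sigma f h.
Proof. by apply: filterS2 => x -> ->. Qed.

Lemma L2_linear_forms : linear_forms `<=` L2 sigma.
Proof.
move=> f [mRe mIm [a [b fab]]]; split=> //.
rewrite (ae_eq_integral (fun x =>
  (linear_form a x ^+ 2 + linear_form b x ^+ 2)%:E)) //=.
- pose A := \sum_i `|a i 0|; pose B := \sum_i `|b i 0|.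
  have : sigma.-integrable setT (EFin \o
      (fun x => linear_form a x ^+ 2 + linear_form b x ^+ 2)).
    apply: (@integrable_bounded _ _ _ _ _ (A ^+ 2 + B ^+ 2)).
      by apply: measurable_funD; apply: measurable_funX;
        exact: measurable_linear_form.
    move=> x; rewrite (le_trans (ler_normD _ _))// !normrX.
    have := linear_form_bound a x; have := linear_form_bound b x.
    by rewrite -/A -/B => ? ?; rewrite lerD// lerXn2r ?nnegrE ?sumr_ge0.
  move=> /integrableP[_];
    under eq_integral do rewrite /= ger0_norm ?addr_ge0 ?sqr_ge0//.
  by [].
- by apply/measurable_EFinP; apply: measurable_funD; apply: measurable_funX.
- apply/measurable_EFinP; apply: measurable_funD; apply: measurable_funX;
  exact: measurable_linear_form.
- by apply: filterS fab => x -> _.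
Qed.

Lemma complex_form_in a b : linear_forms (complex_form a b).
Proof.
split; [exact: measurable_linear_form|exact: measurable_linear_form|].
by exists a, b; exact: eqL2_refl.
Qed.

Lemma complex_form_comb (c : R[i]) a b a' b' x :
  c * complex_form a b x + complex_form a' b' x =
  complex_form (Re c *: a - Im c *: b + a') (Re c *: b + Im c *: a + b') x.
Proof.
case: c => p q; rewrite /complex_form -!scaleNr !linear_formD !linear_formZ /=.
by simpc; congr (_ +i* _); ring.
Qed.

Lemma complex_form_SO (g : SO R n) a b x :
  complex_form (sval g *m a) (sval g *m b) (SO_act g x) = complex_form a b x.
Proof. by rewrite /complex_form !linear_form_SO. Qed.

Lemma SO_actK (g : SO R n) x : SO_act g (SO_act (SO_inv g) x) = x.
Proof.
apply: val_inj => /=; rewrite mulmxA mulmxV ?mul1mx//.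
by case: g => g /= /andP[_ /eqP dg]; rewrite unitmxE dg unitr1.
Qed.

Lemma translate_complex_form (g : SO R n) a b :
  translate g (complex_form a b) = complex_form (sval g *m a) (sval g *m b).
Proof.
by apply/funext => x; rewrite /translate -(complex_form_SO g) SO_actK.
Qed.

Lemma ae_SO_act (g : SO R n) (Q : sphere R n -> Prop) :
  {ae sigma, forall x, Q x} -> {ae sigma, forall x, Q (SO_act g x)}.
Proof.
move=> [N [mN N0 QN]]; exists (SO_act g @^-1` N); split.
- by rewrite -[X in measurable X]setTI; exact: measurable_SO_act.
- by rewrite -N0 -(hsigma g mN).
- by move=> x /= nQ; apply: QN.
Qed.

Lemma linear_forms_module : SO_module sigma linear_forms.
Proof.
split; first split.
- exact: L2_linear_forms.
- have := complex_form_in 0 0; congr linear_forms; apply/funext => x.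
  have z : linear_form (0 : 'cV[R]_n.+1) x = 0.
    by rewrite /linear_form /dot big1// => i _; rewrite mxE mul0r.
  by rewrite /complex_form z.
- move=> c f g [mf1 mf2 [a [b fab]]] [mg1 mg2 [a' [b' gab]]]; split.
  + rewrite (_ : (fun _ => _) = fun x =>
      Re c * Re (f x) - Im c * Im (f x) + Re (g x)).
      by apply: measurable_funD => //; apply: measurable_funB;
        apply: measurable_funM.
    by apply/funext => x; case: c (f x) (g x) => [? ?] [? ?] [? ?].
  + rewrite (_ : (fun _ => _) = fun x =>
      Re c * Im (f x) + Im c * Re (f x) + Im (g x)).
      by apply: measurable_funD => //; apply: measurable_funD;
        apply: measurable_funM.
    by apply/funext => x; case: c (f x) (g x) => [? ?] [? ?] [? ?].
  + eexists; eexists; apply: filterS2 fab gab => x -> ->.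
    exact: complex_form_comb.
- move=> f g [_ _ [a [b fab]]] [mg1 mg2 _] fg; split=> //.
  by exists a, b; exact: eqL2_trans (eqL2_sym fg) fab.
- move=> h f [mf1 mf2 [a [b fab]]]; split.
  + exact: (measurableT_comp mf1 (measurable_SO_act _)).
  + exact: (measurableT_comp mf2 (measurable_SO_act _)).
  + exists (sval h *m a), (sval h *m b); rewrite -translate_complex_form.
    exact: (ae_SO_act (SO_inv h) fab).
Qed.

Lemma ae_linear_form0 a : {ae sigma, forall x, linear_form a x = 0} -> a = 0.
Proof.
move=> a0; apply/eqP; rewrite -dot_eq0; apply/eqP.
have : \int[sigma]_x (linear_form a x * linear_form a x) = 0.
  rewrite -[RHS](mean_cst sigma 0); apply: ae_eq_mean => //.
    by apply: measurable_funM; exact: measurable_linear_form.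
  by apply: filterS a0 => x ->; rewrite mul0r.
rewrite mean_linear_form2// => /eqP; rewrite mulf_eq0 invr_eq0 pnatr_eq0 orbF.
by move/eqP.
Qed.

(** Let a submodule contain the form of a vector with [i]-th coordinate [z <>
    0]. Let [g], [h] be half-turns that flip [i] together with two distinct
    other coordinates. Then [(1 - h)(1 - g)] maps that vector to [4 z e_i], so
    [e_i] is in the submodule, and quarter-turns give the rest of the basis.
    Three coordinates are needed: the module is reducible on the circle. *)
Lemma linear_forms_irreducible : irreducible_module sigma linear_forms.
Proof.
split; first exact: linear_forms_module.
  exists (complex_form (basis_vec R ord0) 0); first exact: complex_form_in.
  move=> h; have /ae_linear_form0 : {ae sigma, forall x,
    linear_form (basis_vec R ord0) x = 0}.
    by apply: filterS h => x [->].
  move/(congr1 (fun u => u ord0 0)); rewrite basis_vecE mxE eqxx => /eqP.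
  by rewrite oner_eq0.
move=> U [[UL2 U0 Ulin Uae] Utr] UW.
have [|/existsNP[f /not_implyP[Uf f0]]] := pselect (forall f, U f ->
  eqL2 sigma f (fun=> 0)).
  by left.
right; pose Uc a b := U (complex_form a b).
have Ucomb (c : R[i]) a b a' b' : Uc a b -> Uc a' b' ->
    Uc (Re c *: a - Im c *: b + a') (Re c *: b + Im c *: a + b').
  move=> h h'; have := Ulin c _ _ h h'; congr U; apply/funext => x.
  exact: complex_form_comb.
have Urot (g : SO R n) a b : Uc a b -> Uc (sval g *m a) (sval g *m b).
  by move=> /(Utr g); rewrite translate_complex_form.
have [_ _ [a [b fab]]] := UW _ Uf.
have Uab : Uc a b by apply: Uae fab => //; apply: L2_linear_forms;
  exact: complex_form_in.
have [i ab0] : exists i, (a i 0 != 0) || (b i 0 != 0).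
  apply/not_existsP => ab0; apply: f0.
  have a0 i : a i 0 = 0 by have /negP := ab0 i;
    rewrite negb_or !negbK => /andP[/eqP].
  have b0 i : b i 0 = 0 by have /negP := ab0 i;
    rewrite negb_or !negbK => /andP[_ /eqP].
  apply: eqL2_trans fab _; apply: aeW => x;
    rewrite /complex_form /linear_form /dot.
  by rewrite !big1// => i _; rewrite ?a0 ?b0 mul0r.
have [l] := third_index n2 i i; rewrite andbb => li.
have [m /andP[mi ml]] := third_index n2 i l.
have Usub a1 b1 a2 b2 : Uc a1 b1 -> Uc a2 b2 -> Uc (a1 - a2) (b1 - b2).
  move=> h1 h2; have := Ucomb (-1) _ _ _ _ h2 h1;
    rewrite /= oppr0 !scale0r !scaleN1r.
  by rewrite subr0 addr0 !(addrC (- _)).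
have il : i != l by rewrite eq_sym.
have im : i != m by rewrite eq_sym.
have [g gE] := half_turn R il; have [h hE] := half_turn R im.
have U1 := Usub _ _ _ _ Uab (Urot g _ _ Uab).
have U2 := Usub _ _ _ _ U1 (Urot h _ _ U1).
have E (u : 'cV[R]_n.+1) : u - sval g *m u - sval h *m (u - sval g *m u) =
  (4 * u i 0) *: basis_vec R i.
  rewrite hE !gE; apply/colP => k; rewrite !mxE.
  rewrite !eqxx !andbT (negPf il) (negPf ml) (eq_sym m i) (negPf im) /=.
  case: (k == i) (k == l) (k == m) => [] [] [] /=; ring.
rewrite !E in U2.
have Uc0 : Uc 0 0.
  have := U0; congr U; apply/funext => x.
  by rewrite /complex_form /linear_form /dot !big1// => ? _; rewrite mxE mul0r.
have Ui : Uc (basis_vec R i) 0.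
  have z0 : (4 * a i 0 +i* (4 * b i 0)) != 0 :> R[i].
    rewrite eq_complex/= !mulf_eq0 pnatr_eq0/=.
    by case/orP: ab0 => /negPf ->; rewrite ?andbF.
  set z := (_ +i* _) in z0; pose c := z^-1.
  have := Ucomb c _ _ _ _ U2 Uc0; rewrite !addr0 !scalerA -scalerBl -scalerDl.
  have cz : c * z = 1 by rewrite mulVf.
  have -> : Re c * (4 * a i 0) - Im c * (4 * b i 0) = Re (c * z) by case: (c).
  have -> : Re c * (4 * b i 0) + Im c * (4 * a i 0) = Im (c * z).
    by case: (c) => ? ?.
  by rewrite cz scale1r scale0r.
have Uj j : Uc (basis_vec R j) 0.
  have [<-//|ij] := eqVneq i j; have [q qE] := quarter_turn R ij.
  have := Urot q _ _ Ui; rewrite !qE; congr Uc; apply/colP => k; rewrite !mxE;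
    last ring.
  rewrite !eqxx !andbT (eq_sym j i) (negPf ij)/=; ring.
have Uall (r : seq 'I_n.+1) u v : Uc (\sum_(j <- r) u j 0 *: basis_vec R j)
    (\sum_(j <- r) v j 0 *: basis_vec R j).
  elim: r => [|j r IHr]; first by rewrite !big_nil.
  have := Ucomb (u j 0 +i* v j 0) _ _ _ _ (Uj j) IHr.
  by rewrite !big_cons/= !scaler0 subr0 add0r.
have decomp u : u = \sum_(j <- enum 'I_n.+1) u j 0 *: basis_vec R j.
  apply/colP => k; rewrite summxE big_enum/= (bigD1 k)//= big1 ?addr0.
    by rewrite !mxE !eqxx mulr1.
  by move=> j /negPf jk; rewrite !mxE (eq_sym k) jk/= mulr0.
apply/seteqP; split=> // g' Wg; have [_ _ [u [v guv]]] := Wg.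
apply: (Uae (complex_form u v)); last exact: eqL2_sym.
  by rewrite (decomp u) (decomp v); exact: Uall.
exact: L2_linear_forms.
Qed.

Lemma linear_forms_dimension : has_dimension sigma linear_forms n.+1.
Proof.
exists (fun i => complex_form (basis_vec R i) 0).
have sumE (c : 'I_n.+1 -> R[i]) (x : sphere R n) (s : seq 'I_n.+1) :
    \sum_(i <- s) c i * complex_form (basis_vec R i) 0 x =
    complex_form (\sum_(i <- s) Re (c i) *: basis_vec R i)
                 (\sum_(i <- s) Im (c i) *: basis_vec R i) x.
  elim: s => [|i s IHs].
    by rewrite !big_nil /complex_form /linear_form /dot !big1// => ? _;
      rewrite mxE mul0r.
  by rewrite !big_cons IHs complex_form_comb !scaler0 subr0 add0r.
have coordE (c : 'I_n.+1 -> R) k :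
    (\sum_(i < n.+1) c i *: basis_vec R i) k 0 = c k.
  rewrite summxE (bigD1 k)//= big1 ?addr0; first by rewrite !mxE !eqxx mulr1.
  by move=> j /negPf jk; rewrite !mxE (eq_sym k) jk/= mulr0.
split.
- by move=> i; exact: complex_form_in.
- move=> c c0 i.
  have /ae_linear_form0 a0 : {ae sigma, forall x,
      linear_form (\sum_(i < n.+1) Re (c i) *: basis_vec R i) x = 0}.
    by apply: filterS c0 => x; rewrite sumE => -[].
  have /ae_linear_form0 b0 : {ae sigma, forall x,
      linear_form (\sum_(i < n.+1) Im (c i) *: basis_vec R i) x = 0}.
    by apply: filterS c0 => x; rewrite sumE => -[].
  have := coordE (fun i => Re (c i)) i; have := coordE (fun i => Im (c i)) i.
  by rewrite a0 b0 !mxE; case: (c i) => p q /= <- <-.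
- move=> f [_ _ [a [b fab]]]; exists (fun i => a i 0 +i* b i 0).
  apply: eqL2_trans fab _; apply: aeW => x; rewrite sumE big_enum/= big_enum/=.
  by congr complex_form; apply/colP => k; rewrite coordE.
Qed.

Lemma linear_forms_nonconstant : linear_forms <> constants sigma.
Proof.
move=> h; have : constants sigma (complex_form (basis_vec R ord0) 0).
  by rewrite -h; exact: complex_form_in.
move=> [_ [c hc]].
have hc1 : {ae sigma, forall x, linear_form (basis_vec R ord0) x = Re c}.
  by apply: filterS hc => x <-.
have mc := @measurable_linear_form R n (basis_vec R ord0).
have m1 : Re c = 0.
  rewrite -(mean_cst sigma (Re c)) -(mean_coord hsigma n2 ord0).
  apply: ae_eq_mean => //; first exact: measurable_coord.
  by apply: filterS hc1 => x <-; rewrite /linear_form dot_basis_vec.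
have /ae_linear_form0 : {ae sigma, forall x,
  linear_form (basis_vec R ord0) x = 0}.
  by rewrite -m1.
move/(congr1 (fun u : 'cV[R]_n.+1 => u ord0 0));
  rewrite basis_vecE mxE eqxx => /eqP.
by rewrite oner_eq0.
Qed.

(** The coordinates span an irreducible module of dimension [n.+1], so a module
    smaller than all the others cannot differ from it. *)
Lemma smallest_module_linear_forms V :
  smallest_nonconstant_irreducible sigma V n.+1 -> V = linear_forms.
Proof.
move=> [_ _ _ small]; have [//|VW] := pselect (V = linear_forms).
exfalso.
have := small linear_forms n.+1 linear_forms_irreducible
  linear_forms_nonconstant
  linear_forms_dimension (fun h => VW (esym h)).
by rewrite ltnn.
Qed.

End complex_forms.

(** * Truncation of a square integrable field *)

Section unbounded_fields.
Context d (X : measurableType d) d' (W : measurableType d') (R : realType).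
Variables (sigma : probability X R) (P : probability W R).
Variable T : X -> W -> R.
Hypothesis mT : measurable_fun setT (fun z : X * W => T z.1 z.2).

(** Tonelli for the positive and negative parts of the field gives
    measurability at all [w], also where the section [T ^~ w] is not
    integrable. *)
Lemma measurable_field_meanT (f : X -> R) : measurable_fun setT f ->
  measurable_fun setT (field_mean sigma T f).
Proof.
move=> mf; pose F (z : X * W) := (T z.1 z.2 * f z.1)%:E.
have mF : measurable_fun setT F.
  apply/measurable_EFinP; apply: measurable_funM => //.
  exact: measurableT_comp.
rewrite (_ : field_mean sigma T f = fun w => fine
    (fubini_G sigma F^\+%E w - fubini_G sigma F^\-%E w)%E).
  apply: measurableT_comp => //; apply: emeasurable_funB.
  - apply: (measurable_fun_fubini_tonelli_G (m1 := sigma) F^\+%E) => //.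
    exact: measurable_funepos.
  - apply: (measurable_fun_fubini_tonelli_G (m1 := sigma) F^\-%E) => //.
    exact: measurable_funeneg.
apply/funext => w; rewrite /field_mean /Rintegral [in LHS]integralE.
by congr (fine (_ - _)%E); apply: eq_integral => x _;
  rewrite ?funeposE ?funenegE.
Qed.

Definition clip (n : nat) (t : R) : R := Num.max (- n%:R) (Num.min t n%:R).

Lemma clip_bound n t : `|clip n t| <= n%:R.
Proof.
rewrite ler_norml /clip le_max lexx/= ge_max ge_min lexx orbT andbT.
by rewrite (le_trans (y := 0)) ?oppr_le0.
Qed.

Lemma clip_le n t : `|clip n t| <= `|t|.
Proof.
have n0 : 0 <= n%:R :> R by [].
have t0 := normr_ge0 t; have t1 := ler_norm t.
have t2 : - `|t| <= t by rewrite lerNl -normrN ler_norm.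
rewrite ler_norml /clip le_max ge_max le_min ge_min t1 t2 /=.
by apply/andP; split; [apply/orP; right|rewrite andbT]; lra.
Qed.

Lemma clip_cvg t : clip n t @[n --> \oo] --> t.
Proof.
apply: cvg_near_cst; exists (Num.trunc `|t|).+1 => // n /= tn.
have tn' : `|t| < n%:R.
  by rewrite (lt_le_trans (truncnS_gt _))// ler_nat.
move: tn'; rewrite ltr_norml => /andP[t1 t2].
rewrite /clip; case: (leP t n%:R) => ?; case: leP => ? //; lra.
Qed.

Lemma measurable_clip n : measurable_fun setT (clip n).
Proof. by apply: measurable_maxr => //; apply: measurable_minr. Qed.

Hypothesis T2 : {ae P, forall w, (\int[sigma]_x (`|T x w| ^+ 2)%:E < +oo)%E}.

Let mTw w : measurable_fun setT (T ^~ w).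
Proof. exact: (measurable_fun_pair1 w mT). Qed.

Lemma ae_integrable_field : {ae P, forall w,
  sigma.-integrable setT (EFin \o (T ^~ w))}.
Proof.
apply: filterS T2 => w Tw; apply/integrableP; split;
  first exact/measurable_EFinP.
apply: (@le_lt_trans _ _ (\int[sigma]_x ((1 + `|T x w| ^+ 2)%:E))%E).
  apply: ge0_le_integral => //.
  - by apply/measurable_EFinP; exact: measurableT_comp.
  - apply/measurable_EFinP; apply: measurable_funD => //.
    by apply: measurable_funX; exact: measurableT_comp.
  - move=> x _; rewrite /= lee_fin; have := sqr_ge0 (`|T x w| - 1); nra.
under eq_integral do rewrite EFinD.
rewrite ge0_integralD//.
- rewrite (integral_cst sigma measurableT 1%:E).
  have := probability_setT sigma; move=> /= ->.
  by rewrite mule1 lte_add_pinfty ?ltry.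
- apply/measurable_EFinP/measurable_funX; exact: measurableT_comp.
Qed.

Variables (f : X -> R) (C : R).
Hypotheses (mf : measurable_fun setT f) (fC : forall x, `|f x| <= C).

Lemma integrable_field_weight w : sigma.-integrable setT (EFin \o (T ^~ w)) ->
  sigma.-integrable setT (EFin \o (fun x => T x w * f x)).
Proof.
move=> iT; have := integrableZl measurableT C iT.
apply: le_integrable => //.
  by apply/measurable_EFinP; apply: measurable_funM.
move=> x _ /=; rewrite lee_fin !normrM mulrC ler_wpM2r// (le_trans (fC x))//.
exact: ler_norm.
Qed.

Lemma cvg_field_mean_clip w : sigma.-integrable setT (EFin \o (T ^~ w)) ->
  field_mean sigma (fun x w => clip n (T x w)) f w @[n --> \oo] -->
  field_mean sigma T f w.
Proof.
move=> iT; have iTf := integrable_field_weight iT.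
have [|||||_ _ c] := @dominated_convergence _ _ _ sigma setT measurableT
  (fun n x => (clip n (T x w) * f x)%:E) (EFin \o (fun x => T x w * f x))
  (fun x => `|T x w * f x|%:E).
- move=> n; apply/measurable_EFinP; apply: measurable_funM => //.
  exact: measurableT_comp (measurable_clip n) (mTw w).
- by apply/measurable_EFinP; apply: measurable_funM.
- apply: aeW => x _; apply: cvg_EFin; first exact: nearW.
  by apply: cvgM; [exact: clip_cvg|exact: cvg_cst].
- exact: integrable_abse iTf.
- apply: aeW => x n _; rewrite /= lee_fin !normrM ler_wpM2r//.
  exact: clip_le.
by apply: fine_cvg; rewrite fineK//; exact: integrable_fin_num.
Qed.

Lemma measurable_clip_field n :
  measurable_fun setT (fun z : X * W => clip n (T z.1 z.2)).
Proof. exact: measurableT_comp (measurable_clip n) mT. Qed.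

(** The clipped fields are bounded, so that moments determine their
    coefficients; this limit extends to the field what holds for all of them.
    *)
Lemma cvg_mean_cos_clip (c : R) :
  \int[P]_w cos (field_mean sigma (fun x w =>
    clip n (T x w)) f w + c) @[n --> \oo] -->
  \int[P]_w cos (field_mean sigma T f w + c).
Proof.
have mcos := measurable_cosD c.
apply: (@dominated_mean _ _ _ P _ _ 1).
- move=> n; apply: (measurableT_comp mcos).
  exact: (measurable_field_mean sigma P (measurable_clip_field n)
    (fun x w => clip_bound n (T x w)) mf fC).
- by apply: (measurableT_comp mcos); exact: measurable_field_meanT.
- by move=> n w; exact: cos_max.
- apply: filterS ae_integrable_field => w iT.
  exact: (cvg_comp _ _ (cvg_field_mean_clip iT) (@continuous_cosD R c _)).
Qed.

End unbounded_fields.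

(** * Invariance of the law of the coefficients *)

Section invariant_fields.
Context (R : realType) (n : nat).
Variable sigma : probability (sphere R n) R.
Hypothesis hsigma : rotation_invariant sigma.
Context (dO : measure_display) (Omega : measurableType dO).
Variables (P : probability Omega R) (T : sphere R n -> Omega -> R).
Hypothesis hT : invariant_random_field sigma P T.
Implicit Types u v : 'cV[R]_n.+1.

Let mT : measurable_fun setT (fun z : sphere R n * Omega => T z.1 z.2).
Proof. by case: hT. Qed.

Let T2 : as_square_integrable sigma P T. Proof. by case: hT. Qed.

Lemma measurable_field_vector m (x : 'I_m -> sphere R n) :
  measurable_fun setT (field_vector T x).
Proof.
apply/measurable_fun_tnthP => i.
rewrite (_ : _ \o _ = T (x i)); first exact: (measurable_fun_pair2 (x i) mT).
by apply/funext => w /=; rewrite tnth_mktuple.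
Qed.

Lemma mean_field_vector_SO (g : SO R n) m (x : 'I_m -> sphere R n)
    (F : m.-tuple R -> R) (M : R) :
  measurable_fun setT F -> (forall t, `|F t| <= M) ->
  \int[P]_w F (field_vector T (fun i => SO_act g (x i)) w) =
  \int[P]_w F (field_vector T x w).
Proof.
move=> mF FM.
pose h1 : {RV P >-> m.-tuple R} := HB.pack (field_vector T (fun i =>
  SO_act g (x i)))
  (isMeasurableFun.Build _ _ _ _ _ (measurable_field_vector (fun i =>
    SO_act g (x i)))).
pose h2 : {RV P >-> m.-tuple R} := HB.pack (field_vector T x)
  (isMeasurableFun.Build _ _ _ _ _ (measurable_field_vector x)).
rewrite -(mean_distribution h1 mF FM) -(mean_distribution h2 mF FM); congr fine.
by apply: eq_measure_integral => A mA _; case: hT => _ _; exact.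
Qed.

Lemma mean_prod_clip_SO (g : SO R n) k (ys : seq (sphere R n)) :
  \int[P]_w \prod_(y <- ys) clip k (T (SO_act g y) w) =
  \int[P]_w \prod_(y <- ys) clip k (T y w).
Proof.
pose x (i : 'I_(size ys)) := tnth (in_tuple ys) i.
pose F (t : (size ys).-tuple R) := \prod_i clip k (tnth t i).
have mF : measurable_fun setT F.
  apply: measurable_prod => i _.
  exact: measurableT_comp (measurable_clip k) (measurable_tnth i).
have FM t : `|F t| <= \prod_(i < size ys) k%:R.
  by rewrite normr_prod; apply: ler_prod => i _; rewrite normr_ge0 clip_bound.
have FE (y : 'I_(size ys) -> sphere R n) w :
    F (field_vector T y w) = \prod_i clip k (T (y i) w).
  by apply: eq_bigr => i _; rewrite tnth_mktuple.
have := mean_field_vector_SO g x mF FM.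
under eq_Rintegral do rewrite FE.
under [X in _ = X -> _]eq_Rintegral do rewrite FE.
move=> h; transitivity (\int[P]_w \prod_i clip k (T (SO_act g (x i)) w)).
  by apply: eq_Rintegral => w _; rewrite big_tnth.
by rewrite h; apply: eq_Rintegral => w _; rewrite [RHS]big_tnth.
Qed.

Definition field_coef u (w : Omega) : R := field_mean sigma T (linear_form u) w.

(** [c = 0] and [c = - pi / 2] give the real and the imaginary part of the
    characteristic function of [field_coef u] at 1, hence at every real since
    [u] may be rescaled. *)
Definition field_cf u (c : R) : R := \int[P]_w cos (field_coef u w + c).

(** For a clipped field, the change of variables [x |-> g x] turns the
    coefficient along [g u] into the coefficient along [u] of the rotated
    field, which has the same finite-dimensional laws. The clipping is then
    removed. *)
Lemma field_cf_SO (g : SO R n) u c : field_cf (sval g *m u) c = field_cf u c.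
Proof.
have cu := cvg_mean_cos_clip mT T2 (measurable_linear_form u)
  (linear_form_bound u) (c := c).
have cgu := cvg_mean_cos_clip mT T2 (measurable_linear_form (sval g *m u))
  (linear_form_bound (sval g *m u)) (c := c).
suff E k : \int[P]_w cos (field_mean sigma (fun x w => clip k (T x w))
      (linear_form (sval g *m u)) w + c) =
    \int[P]_w cos (field_mean sigma (fun x w =>
      clip k (T x w)) (linear_form u) w + c).
  move: cgu; under eq_fun do rewrite E.
  by move=> cgu; exact: (cvg_unique (@Rhausdorff R) cgu cu).
pose S x w := clip k (T x w); pose S' x w := S (SO_act g x) w.
have mS : measurable_fun setT (fun z : sphere R n * Omega => S z.1 z.2).
  exact: measurable_clip_field.
have mS' : measurable_fun setT (fun z : sphere R n * Omega => S' z.1 z.2).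
  have mg : measurable_fun setT (fun z : sphere R n * Omega =>
    (SO_act g z.1, z.2)).
    apply: measurable_fun_pair => //.
    exact: measurableT_comp (@measurable_SO_act R n g) measurable_fst.
  exact: (measurableT_comp mS mg).
have Sk x w : `|S x w| <= k%:R by exact: clip_bound.
have S'k x w : `|S' x w| <= k%:R by exact: clip_bound.
have mu := @measurable_linear_form R n u; have bu := @linear_form_bound R n u.
have SS' ys : \int[P]_w \prod_(y <- ys) S y w =
  \int[P]_w \prod_(y <- ys) S' y w.
  by rewrite /S' /S mean_prod_clip_SO.
rewrite (same_law_field_mean sigma c mS mS' Sk S'k mu bu SS').
apply: eq_Rintegral => w _; congr (cos (_ + c)); rewrite /field_mean.
pose f x := S x w * linear_form (sval g *m u) x.
have mf : measurable_fun setT f.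
  apply: measurable_funM; first exact: (measurable_fun_pair1 w mS).
  exact: measurable_linear_form.
have fM x : `|f x| <= k%:R * \sum_i `|(sval g *m u) i 0|.
  by rewrite normrM ler_pM// linear_form_bound.
rewrite -(mean_SO_act hsigma g mf fM); apply: eq_Rintegral => x _.
by rewrite /f linear_form_SO.
Qed.

Lemma measurable_field_coef u : measurable_fun setT (field_coef u).
Proof. by apply: measurable_field_meanT => //;
  exact: measurable_linear_form. Qed.

Lemma field_coef_lin a u b v : {ae P, forall w,
  field_coef (a *: u + b *: v) w = a * field_coef u w + b * field_coef v w}.
Proof.
apply: filterS (ae_integrable_field mT T2) => w iT.
have iu z := integrable_field_weight mT (measurable_linear_form z)
  (linear_form_bound z) iT.
rewrite /field_coef /field_mean -!RintegralZl// -RintegralD//.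
- apply: eq_Rintegral => x _.
  by rewrite linear_formD !linear_formZ mulrDr !(mulrCA (T x w)).
- exact: (integrableZl measurableT a (iu u)).
- exact: (integrableZl measurableT b (iu v)).
Qed.

Let mean_cos_ae (Y Z : Omega -> R) (c : R) :
  measurable_fun setT Y -> measurable_fun setT Z ->
  {ae P, forall w, Y w = Z w} ->
  \int[P]_w cos (Y w + c) = \int[P]_w cos (Z w + c).
Proof.
move=> mY mZ YZ; have mcos := measurable_cosD c.
apply: ae_eq_mean; [exact: (measurableT_comp mcos)|exact: (measurableT_comp
  mcos)|].
by apply: filterS YZ => w ->.
Qed.

Lemma field_cf_lin a u b v c : field_cf (a *: u + b *: v) c =
  \int[P]_w cos (a * field_coef u w + b * field_coef v w + c).
Proof.
apply: mean_cos_ae; [exact: measurable_field_coef| |exact: field_coef_lin].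
by apply: measurable_funD; apply: measurable_funM => //;
  exact: measurable_field_coef.
Qed.

Lemma field_cfZ a u c : field_cf (a *: u) c =
  \int[P]_w cos (a * field_coef u w + c).
Proof.
have := field_cf_lin a u 0 0 c; rewrite scale0r addr0 => ->.
by apply: eq_Rintegral => w _; rewrite mul0r addr0.
Qed.

End invariant_fields.

(** * Independence and normal laws *)

Section independence.
Context (dO : measure_display) (Omega : measurableType dO) (R : realType).
Variable P : probability Omega R.

(** The joint law of [Y] and [Z] is the product of their laws. *)
Lemma mean_prod_independent (Y Z F G : _ -> R) (M N : R) :
  measurable_fun setT Y -> measurable_fun setT Z ->
  (forall A B : set R, measurable A -> measurable B ->
    P (Y @^-1` A `&` Z @^-1` B) = (P (Y @^-1` A) * P (Z @^-1` B))%E) ->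
  measurable_fun setT F -> measurable_fun setT G ->
  (forall x : R, `|F x| <= M) -> (forall x : R, `|G x| <= N) ->
  \int[P]_w (F (Y w) * G (Z w)) = \int[P]_w F (Y w) * \int[P]_w G (Z w).
Proof.
move=> mY mZ YZ mF mG FM GN.
pose mR := measurableTypeR R.
pose hY : {RV P >-> mR} := HB.pack (Y : Omega ->
  mR) (isMeasurableFun.Build _ _ _ _ (Y : Omega -> mR) mY).
pose hZ : {RV P >-> mR} := HB.pack (Z : Omega ->
  mR) (isMeasurableFun.Build _ _ _ _ (Z : Omega -> mR) mZ).
have mYZ : measurable_fun setT (fun w => (Y w, Z w) : mR * mR).
  exact: measurable_fun_pair.
pose hYZ : {RV P >-> (mR * mR)%type} := HB.pack (fun w => (Y w, Z w) : mR * mR)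
  (isMeasurableFun.Build _ _ _ _ _ mYZ).
pose h (z : mR * mR) : R := F z.1 * G z.2.
have mh : measurable_fun setT h.
  by apply: measurable_funM; exact: measurableT_comp.
have hMN z : `|h z| <= M * N by rewrite normrM ler_pM.
rewrite -(mean_distribution hYZ mh hMN).
rewrite -(mean_distribution hY mF FM) -(mean_distribution hZ mG GN).
set mu := distribution P hY; set nu := distribution P hZ.
have iF := integrable_bounded mu mF FM.
have iG := integrable_bounded nu mG GN.
transitivity (\int[mu]_x \int[nu]_y h (x, y)); last first.
  rewrite -RintegralZr//; apply: eq_Rintegral => x _.
  by rewrite -RintegralZl.
have E : (\int[distribution P hYZ]_z (h z)%:E =
  \int[(mu \x nu)%E]_z (h z)%:E)%E.
  apply: eq_measure_integral => A mA _; apply/esym.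
  by apply: product_measure_unique => // B C mB mC; exact: YZ.
rewrite {1}/Rintegral E; congr fine.
have ih := integrable_prod_bounded mu nu mh hMN.
rewrite -(integral12_prod_meas1 ih); apply: eq_integral => x _.
rewrite /fubini_F /Rintegral fineK//; apply: integrable_fin_num => //.
apply: (@integrable_bounded _ _ _ nu (fun y => h (x, y)) (M * N)) => //.
exact: (measurable_fun_pair2 x mh).
Qed.

Lemma mean_cosD_independent (Y Z : Omega -> R) :
  measurable_fun setT Y -> measurable_fun setT Z ->
  (forall A B : set R, measurable A -> measurable B ->
    P (Y @^-1` A `&` Z @^-1` B) = (P (Y @^-1` A) * P (Z @^-1` B))%E) ->
  forall a b : R, \int[P]_w cos (a * Y w + b * Z w) =
    \int[P]_w cos (a * Y w) * \int[P]_w cos (b * Z w) -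
    \int[P]_w sin (a * Y w) * \int[P]_w sin (b * Z w).
Proof.
move=> mY mZ YZ a b.
have mc (t : R) : measurable_fun setT (fun x : R => cos (t * x)).
  rewrite (_ : (fun _ => _) = (fun x => cos (t * x + 0)));
    first exact: measurable_cosM.
  by apply/funext => x; rewrite addr0.
have ms (t : R) : measurable_fun setT (fun x : R => sin (t * x)).
  rewrite (_ : (fun _ => _) = (fun x => sin (t * x + 0)));
    first exact: measurable_sinM.
  by apply/funext => x; rewrite addr0.
have c1 (t x : R) : `|cos (t * x)| <= 1 by exact: cos_max.
have s1 (t x : R) : `|sin (t * x)| <= 1 by exact: sin_max.
rewrite -(mean_prod_independent mY mZ YZ (mc a) (mc b) (c1 a) (c1 b)).
rewrite -(mean_prod_independent mY mZ YZ (ms a) (ms b) (s1 a) (s1 b)).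
rewrite -RintegralB//.
- by apply: eq_Rintegral => w _; rewrite cosD.
- apply: (@integrable_bounded _ _ _ _ _ 1).
    by apply: measurable_funM;
      [exact: measurableT_comp (mc a) mY|exact: measurableT_comp (mc b) mZ].
  by move=> w; rewrite normrM mulr_ile1.
- apply: (@integrable_bounded _ _ _ _ _ 1).
    by apply: measurable_funM;
      [exact: measurableT_comp (ms a) mY|exact: measurableT_comp (ms b) mZ].
  by move=> w; rewrite normrM mulr_ile1.
Qed.

End independence.

Section gaussian.
Context (R : realType).

Lemma gaussian_law_cf (mu : probability (measurableTypeR R) R) (k : R) :
  0 <= k ->
  (forall t c : R, \int[mu]_x cos (t * x + c) =
    cos c * expR (- (k * t ^+ 2))) ->
  gaussian_law mu.
Proof.
move=> k0 cf.
(* [k = s^2 / 2], where the variance is [s^2]. *)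
exists 0, (Num.sqrt (2 * k)) => A mA; case: eqVneq => [s0|s0].
  have k00 : k = 0.
    by move/eqP: s0; rewrite sqrtr_eq0 => ?; lra.
  apply: (@cf_unique R mu (dirac (0 : measurableTypeR R))) => // t c.
  rewrite cf k00 mul0r oppr0 expR0 mulr1 /Rintegral integral_dirac//.
    by rewrite diracT mul1e mulr0 add0r.
  by apply/measurable_EFinP; exact: measurable_cosM.
apply: (@cf_unique R mu (normal_prob 0 (Num.sqrt (2 * k)))) => // t c.
rewrite cf cf_normal// sqr_sqrtr ?mulr_ge0//; congr (_ * expR _); by field.
Qed.

End gaussian.

(** * The Herschel-Maxwell argument *)

Section orthonormal_coefficients.
Context (R : realType) (n : nat).
Variable sigma : probability (sphere R n) R.
Hypothesis hsigma : rotation_invariant sigma.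
Context (dO : measure_display) (Omega : measurableType dO).
Variables (P : probability Omega R) (T : sphere R n -> Omega -> R).
Hypothesis hT : invariant_random_field sigma P T.
Variables p q : 'cV[R]_n.+1.
Hypotheses (pp : dot p p = 1) (qq : dot q q = 1) (pq : dot p q = 0).

Local Notation X := (field_coef sigma T).
Local Notation cf := (field_cf sigma P T).

Let mX u : measurable_fun setT (X u).
Proof. exact: measurable_field_coef hT u. Qed.

Lemma field_cf_plane_rotation r t c :
  cf ((r * cos t) *: p + (r * sin t) *: q) c = cf (r *: p) c.
Proof.
have [g gE] := rotation_in_plane pp qq pq t.
have -> : (r * cos t) *: p + (r * sin t) *: q = sval g *m (r *: p).
  rewrite gE !dotZr pp (dotC q p) pq; apply/colP => i; rewrite !mxE; ring.
exact: field_cf_SO.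
Qed.

(** The half-turn of the plane of [p], [q] maps [p] to [- p], so the law of [X
    p] is symmetric. *)
Lemma mean_sin_field_coef r : \int[P]_w sin (r * X p w) = 0.
Proof.
have sym c : cf (- r *: p) c = cf (r *: p) c.
  rewrite -(field_cf_plane_rotation r pi) cospi sinpi mulr0 scale0r addr0.
  by rewrite mulrN1.
have E (a : R) : cf (a *: p) (- (pi / 2)) = \int[P]_w sin (a * X p w).
  rewrite (field_cfZ hT); apply: eq_Rintegral => w _.
  by rewrite cosBpihalf.
have := sym (- (pi / 2)); rewrite !E.
have -> : \int[P]_w sin (- r * X p w) = \int[P]_w (-1 * sin (r * X p w)).
  by apply: eq_Rintegral => w _; rewrite mulN1r mulNr sinN.
rewrite RintegralZl//; first by move=> h; lra.
apply: (@integrable_bounded _ _ _ _ _ 1); last by move=> w; exact: sin_max.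
apply: (measurableT_comp (f := @sin R)).
  by apply: continuous_measurable_fun; exact: continuous_sin.
exact: measurable_funM.
Qed.

(** The Herschel-Maxwell argument. By invariance, [E cos(r X)] is the same
    along all unit vectors of the plane of [p], [q]; by independence, it splits
    along [p] and [q]. *)
Lemma field_cf_gaussian :
  (forall A B : set R, measurable A -> measurable B ->
    P (X p @^-1` A `&` X q @^-1` B) = (P (X p @^-1` A) * P (X q @^-1` B))%E) ->
  exists2 k, 0 <= k & forall r c, cf (r *: p) c = cos c * expR (- (k * r ^+ 2)).
Proof.
move=> indep; pose f r := \int[P]_w cos (r * X p w).
have mcos : measurable_fun setT (@cos R).
  by apply: continuous_measurable_fun; exact: continuous_cos.
have mrX r : measurable_fun setT (fun w => r * X p w) by exact: measurable_funM.
have fE r : cf (r *: p) 0 = f r.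
  by rewrite (field_cfZ hT); apply: eq_Rintegral => w _; rewrite addr0.
have [|||r t|k k0 fk] := @herschel_maxwell R f.
- rewrite -[RHS](mean_cst P 1); apply: eq_Rintegral => w _.
  by rewrite mul0r cos0.
- move=> r; rewrite (le_trans (ler_norm _))//.
  apply: le_norm_mean; first exact: measurableT_comp mcos (mrX r).
  by move=> w; exact: cos_max.
- move=> r; rewrite -[X in _ --> X](mean_cst P 1).
  apply: (@dominated_mean _ _ _ P _ _ 1) => //.
  + by move=> m; exact: measurableT_comp mcos (mrX _).
  + by move=> m w; exact: cos_max.
  apply: aeW => w.
  have c0 : r / 2 ^+ m * X p w @[m --> \oo] --> (0 : R).
    rewrite -[X in _ --> X](mulr0 (r * X p w)).
    rewrite (_ : (fun m => _) = fun m => (r * X p w) * 2^-1 ^+ m).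
      apply: cvgM; first exact: cvg_cst.
      by apply: cvg_expr; rewrite ger0_norm ?invr_ge0// invf_lt1// ltr1n.
    by apply/funext => m; rewrite exprVn mulrAC.
  by have := cvg_comp _ _ c0 (@continuous_cos R 0); rewrite cos0.
- rewrite -fE -(field_cf_plane_rotation r t 0) (field_cf_lin hT).
  under eq_Rintegral do rewrite addr0.
  rewrite (mean_cosD_independent (mX p) (mX q) indep).
  rewrite (mean_sin_field_coef (r * cos t)) mul0r subr0; congr (_ * _).
  have := field_cf_plane_rotation (r * sin t) (pi / 2) 0.
  rewrite cos_pihalf sin_pihalf mulr0 scale0r add0r mulr1 fE => <-.
  by rewrite (field_cfZ hT); apply: eq_Rintegral => w _; rewrite addr0.
exists k => // r c; rewrite -fk (field_cfZ hT).
have i1 : P.-integrable setT (EFin \o (fun w => cos (r * X p w))).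
  apply: (@integrable_bounded _ _ _ _ _ 1); last by move=> w; exact: cos_max.
  exact: measurableT_comp mcos (mrX r).
have i2 : P.-integrable setT (EFin \o (fun w => sin (r * X p w))).
  apply: (@integrable_bounded _ _ _ _ _ 1); last by move=> w; exact: sin_max.
  apply: (measurableT_comp (f := @sin R)) => //.
  by apply: continuous_measurable_fun; exact: continuous_sin.
transitivity (cos c * f r - sin c * \int[P]_w sin (r * X p w)); last first.
  by rewrite mean_sin_field_coef mulr0 subr0.
rewrite -!RintegralZl// -RintegralB//.
- by apply: eq_Rintegral => w _; rewrite cosD mulrC [in X in _ - X]mulrC.
- exact: (integrableZl measurableT (cos c) i1).
- exact: (integrableZl measurableT (sin c) i2).
Qed.

End orthonormal_coefficients.

Section indices.

Lemma nonneg_indicesP d k :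
  (k \in nonneg_indices d) = (k <= d./2)%N && (odd d || (k != 0%N)).
Proof. by rewrite mem_filter mem_iota/= ltnS andbC. Qed.

Lemma nonneg_in_indices d (k : nat) : k \in nonneg_indices d ->
  k%:Z \in indices d.
Proof.
rewrite nonneg_indicesP => /andP[kd k0]; rewrite mem_filter; apply/andP;
  split=> //.
apply/mapP; exists (k + d./2)%N; last by rewrite PoszD addrK.
by rewrite mem_iota/= ltnS -addnn leq_add2r.
Qed.

Lemma opp_in_indices d (k : nat) : k \in nonneg_indices d ->
  - k%:Z \in indices d.
Proof.
rewrite nonneg_indicesP => /andP[kd k0]; rewrite mem_filter oppr_eq0.
apply/andP; split=> //.
apply/mapP; exists (d./2 - k)%N; last by rewrite -subzn// addrAC subrr sub0r.
by rewrite mem_iota/= ltnS (leq_trans (leq_subr _ _))// -addnn leq_addr.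
Qed.

Lemma other_index d k : (3 <= d)%N ->
  exists2 k', k' \in nonneg_indices d & k' != k.
Proof.
move=> d3; have d1 : (1 <= d./2)%N by case: d d3 => [|[|[]]].
have [->|k1] := eqVneq k 1%N; last first.
  by exists 1%N; [rewrite nonneg_indicesP d1 orbT|rewrite eq_sym].
have [od|ed] := boolP (odd d); first by exists 0%N;
  rewrite ?nonneg_indicesP ?od.
exists 2%N => //; rewrite nonneg_indicesP orbT andbT.
by case: d d3 ed {d1} => [|[|[|[|d]]]].
Qed.

End indices.

Section coefficients.
Context (R : realType) (n : nat).
Variable sigma : probability (sphere R n) R.
Hypothesis hsigma : rotation_invariant sigma.
Hypothesis n2 : (2 <= n)%N.
Implicit Types a b : 'cV[R]_n.+1.

Let mlf a : measurable_fun setT (linear_form a : sphere R n -> R).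
Proof. exact: measurable_linear_form. Qed.

Lemma inner_complex_form (f g : sphere R n -> R[i]) a b a' b' :
  linear_forms sigma f -> linear_forms sigma g ->
  eqL2 sigma f (complex_form a b) -> eqL2 sigma g (complex_form a' b') ->
  inner sigma f g = ((dot a a' + dot b b') / n.+1%:R)
                    +i* ((dot b a' - dot a b') / n.+1%:R).
Proof.
move=> [mf1 mf2 _] [mg1 mg2 _] fab gab.
have i2 (u u' : 'cV[R]_n.+1) : sigma.-integrable setT
    (EFin \o (fun x => linear_form u x * linear_form u' x)).
  apply: (@integrable_bounded _ _ _ _ _ ((\sum_i `|u i 0|) * \sum_i `|u' i 0|)).
    exact: measurable_funM.
  by move=> x; rewrite normrM ler_pM// linear_form_bound.
rewrite /inner /Cintegral; congr (_ +i* _).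
- transitivity (\int[sigma]_x (linear_form a x * linear_form a' x +
                               linear_form b x * linear_form b' x)).
    apply: ae_eq_mean.
    + rewrite (_ : (fun _ => _) = fun x =>
        Re (f x) * Re (g x) + Im (f x) * Im (g x)).
        by apply: measurable_funD; apply: measurable_funM.
      by apply/funext => x; case: (f x) (g x) => [? ?] [? ?] /=;
        rewrite mulrN opprK.
    + by apply: measurable_funD; apply: measurable_funM.
    + by apply: filterS2 fab gab => x -> -> /=; rewrite mulrN opprK.
  by rewrite RintegralD// !mean_linear_form2// -mulrDl.
- transitivity (\int[sigma]_x (linear_form b x * linear_form a' x -
                               linear_form a x * linear_form b' x)).
    apply: ae_eq_mean.
    + rewrite (_ : (fun _ => _) = fun x =>
        Im (f x) * Re (g x) - Re (f x) * Im (g x)).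
        by apply: measurable_funB; apply: measurable_funM.
      by apply/funext => x; case: (f x) (g x) => [? ?] [? ?] /=; ring.
    + by apply: measurable_funB; apply: measurable_funM.
    + by apply: filterS2 fab gab => x -> -> /=; ring.
  by rewrite RintegralB// !mean_linear_form2// -mulrBl.
Qed.

Context (dO : measure_display) (Omega : measurableType dO).
Variables (P : probability Omega R) (T : sphere R n -> Omega -> R).
Hypothesis hT : invariant_random_field sigma P T.

Lemma coefficient_complex_form (f : sphere R n -> R[i]) a b w :
  linear_forms sigma f -> eqL2 sigma f (complex_form a b) ->
  coefficient sigma T f w =
    field_coef sigma T a w +i* field_coef sigma T (- b) w.
Proof.
move=> [mf1 mf2 _] fab.
have mTw : measurable_fun setT (T ^~ w) by case: hT => mT _ _;
  exact: (measurable_fun_pair1 w mT).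
rewrite /coefficient /Cintegral /field_coef /field_mean; congr (_ +i* _).
  apply: ae_eq_mean.
  - rewrite (_ : (fun _ => _) = fun x => T x w * Re (f x)).
      exact: measurable_funM.
    by apply/funext => x; case: (f x) => ? ? /=; ring.
  - exact: measurable_funM.
  - by apply: filterS fab => x -> /=; ring.
have lfN x : linear_form (- b) x = - linear_form b x.
  by rewrite -scaleN1r linear_formZ mulN1r.
apply: ae_eq_mean.
- rewrite (_ : (fun _ => _) = fun x => - (T x w * Im (f x))).
    by apply: measurable_funN; exact: measurable_funM.
  by apply/funext => x; case: (f x) => ? ? /=; ring.
- exact: measurable_funM.
- by apply: filterS fab => x -> /=; rewrite lfN; ring.
Qed.

End coefficients.

Section maxwell.
Context (R : realType) (n : nat).
Variable sigma : probability (sphere R n) R.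
Hypothesis hsigma : rotation_invariant sigma.
Context (dO : measure_display) (Omega : measurableType dO).
Variables (P : probability Omega R) (T : sphere R n -> Omega -> R).
Hypothesis hT : invariant_random_field sigma P T.
Local Notation X := (field_coef sigma T).

Let mX u : measurable_fun setT (X u).
Proof. exact: measurable_field_coef hT u. Qed.

Lemma eq_measure_ae (E F : set Omega) : measurable E -> measurable F ->
  {ae P, forall w, E w <-> F w} -> P E = P F.
Proof.
move=> mE mF EF; rewrite -(setIT E) -(setIT F) -!integral_indic//.
apply: ae_eq_integral => //; try exact/measurable_EFinP/measurable_indic.
apply: filterS EF => w EFw _; rewrite !indicE; congr (_%:R)%:E.
by congr nat_of_bool; apply/idP/idP; rewrite !inE => /EFw.
Qed.

Section two_blocks.
Variables (Z Z' : Omega -> R[i]) (a b a' b' : 'cV[R]_n.+1).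
Hypothesis ZE : forall w, Z w = X a w +i* X b w.
Hypothesis Z'E : forall w, Z' w = X a' w +i* X b' w.
Hypothesis indep : forall A B : set (R * R), measurable A -> measurable B ->
  P ((fun w => reim (Z w)) @^-1` A `&` (fun w => reim (Z' w)) @^-1` B) =
  (P ((fun w => reim (Z w)) @^-1` A) * P ((fun w => reim (Z' w)) @^-1` B))%E.
Hypothesis ortho : [/\ dot a a' = 0, dot a b' = 0, dot b a' = 0 & dot b b' = 0].
Hypothesis nz' : dot a' a' + dot b' b' != 0.

Let comb (s t : R) (z : R * R) := s * z.1 + t * z.2.

Let mcomb s t : measurable_fun setT (comb s t).
Proof. by apply: measurable_funD; apply: measurable_funM. Qed.

Let independent_comb s t s' t' (A B : set R) : measurable A -> measurable B ->
  P (X (s *: a + t *: b) @^-1` A `&` X (s' *: a' + t' *: b') @^-1` B) =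
  (P (X (s *: a + t *: b) @^-1` A) * P (X (s' *: a' + t' *: b') @^-1` B))%E.
Proof.
move=> mA mB.
have mpre (u : 'cV[R]_n.+1) (C : set R) : measurable C ->
  measurable (X u @^-1` C).
  by move=> mC; rewrite -[X in measurable X]setTI; exact: mX.
have mcpre s1 t1 (C : set R) : measurable C -> measurable (comb s1 t1 @^-1` C).
  by move=> mC; rewrite -[X in measurable X]setTI; exact: mcomb.
have e1 := field_coef_lin hT s a t b; have e2 := field_coef_lin hT s' a' t' b'.
have E (W : Omega -> R[i]) (u v : 'cV[R]_n.+1) s1 t1 (C : set R) :
    (forall w, W w = X u w +i* X v w) ->
    (fun w => reim (W w)) @^-1` (comb s1 t1 @^-1` C) =
    (fun w => s1 * X u w + t1 * X v w) @^-1` C.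
  by move=> WE; apply/seteqP; split => w /=; rewrite /reim WE.
have mE u v s1 t1 (C : set R) : measurable C ->
    measurable ((fun w => s1 * X u w + t1 * X v w) @^-1` C).
  move=> mC; rewrite -[X in measurable X]setTI.
  have mm : measurable_fun setT (fun w => s1 * X u w + t1 * X v w).
    by apply: measurable_funD; apply: measurable_funM.
  exact: mm.
have h := indep (mcpre s t A mA) (mcpre s' t' B mB).
rewrite (E _ _ _ _ _ _ ZE) (E _ _ _ _ _ _ Z'E) in h.
transitivity (P ((fun w => s * X a w + t * X b w) @^-1` A `&`
                 (fun w => s' * X a' w + t' * X b' w) @^-1` B)).
  apply: eq_measure_ae.
  - by apply: measurableI; exact: mpre.
  - by apply: measurableI; exact: mE.
  - by apply: filterS2 e1 e2 => w /= -> ->.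
rewrite h; congr (_ * _)%E; apply: eq_measure_ae.
- exact: mE.
- exact: mpre.
- by apply: filterS e1 => w /= ->.
- exact: mE.
- exact: mpre.
- by apply: filterS e2 => w /= ->.
Qed.

Let normalize (u : 'cV[R]_n.+1) : u != 0 ->
  0 < Num.sqrt (dot u u) /\
  dot ((Num.sqrt (dot u u))^-1 *: u) ((Num.sqrt (dot u u))^-1 *: u) = 1.
Proof.
rewrite -dot_eq0 => u0; have du : 0 < dot u u by rewrite lt0r u0 dot_ge0.
split; first by rewrite sqrtr_gt0.
rewrite dotZl dotZr mulrA -expr2 exprVn sqr_sqrtr ?mulVf//.
exact: ltW.
Qed.

(** [s Re Z + t Im Z] is the coefficient of the field along [xi = s a + t b].
    Any nonzero combination of [a'] and [b'] provides a direction orthogonal to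
    [xi] along which the coefficient is independent of the first one. *)
Lemma gaussian_block : complex_gaussian P Z.
Proof.
have mRe : measurable_fun setT (fun w => Re (Z w) : R).
  by rewrite (_ : (fun _ => _) = X a)//; apply/funext => w; rewrite ZE.
have mIm : measurable_fun setT (fun w => Im (Z w) : R).
  by rewrite (_ : (fun _ => _) = X b)//; apply/funext => w; rewrite ZE.
split=> // s t; pose Y w : R := s * Re (Z w) + t * Im (Z w).
have mY : measurable_fun setT Y by apply: measurable_funD;
  apply: measurable_funM.
pose mR := measurableTypeR R.
pose hY : {RV P >-> mR} := HB.pack (Y : Omega -> mR)
  (isMeasurableFun.Build _ _ _ _ (Y : Omega -> mR) mY).
pose xi := s *: a + t *: b.
suff [k k0 kE] : exists2 k, 0 <= k &
    forall r c, field_cf sigma P T (r *: xi) c = cos c * expR (- (k * r ^+ 2)).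
  apply: (@gaussian_law_cf R (distribution P hY) k k0) => r c.
  rewrite (mean_distribution hY (measurable_cosM r c) (fun x =>
    cos_max (r * x + c))) -kE.
  rewrite /xi scalerDr !scalerA (field_cf_lin hT); apply: eq_Rintegral => w _.
  by rewrite /= /Y ZE/= mulrDr !mulrA.
have [xi0|xi0] := eqVneq xi 0.
  exists 0 => // r c; rewrite xi0 scaler0 mul0r oppr0 expR0 mulr1.
  rewrite -[RHS](mean_cst P (cos c)); apply: eq_Rintegral => w _.
  rewrite /field_coef /field_mean (_ : (fun x => _) = cst 0) ?mean_cst ?add0r//.
  by apply/funext => x; rewrite /linear_form /dot big1 ?mulr0// => i _;
    rewrite mxE mul0r.
have [s' [t' eta0]] : exists s' t', s' *: a' + t' *: b' != 0.
  have [a0|a0] := eqVneq a' 0; last by exists 1, 0;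
    rewrite scale1r scale0r addr0.
  exists 0, 1; rewrite scale0r scale1r add0r; apply: contraNneq nz' => b0.
  by rewrite a0 b0 /dot !big1 ?addr0// => i _; rewrite mxE mul0r.
set eta := s' *: a' + t' *: b' in eta0.
have xe : dot xi eta = 0.
  by case: ortho => h1 h2 h3 h4;
    rewrite /xi /eta dotDl !dotZl !dotDr !dotZr h1 h2 h3 h4; ring.
have [N0 N1] := normalize xi0; have [M0 M1] := normalize eta0.
set N := Num.sqrt (dot xi xi) in N0 N1;
  set M := Num.sqrt (dot eta eta) in M0 M1.
have NM : dot (N^-1 *: xi) (M^-1 *: eta) = 0 by rewrite dotZl dotZr xe !mulr0.
have [|k k0 kE] := field_cf_gaussian hsigma hT N1 M1 NM.
  by move=> A B mA mB; rewrite /xi /eta !scalerDr !scalerA;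
    exact: independent_comb.
exists (k * N ^+ 2); first by rewrite mulr_ge0// sqr_ge0.
move=> r c; have -> : r *: xi = (r * N) *: (N^-1 *: xi).
  by rewrite scalerA mulfK// gt_eqF.
by rewrite kE; congr (_ * expR (- _)); ring.
Qed.

End two_blocks.
End maxwell.

Lemma independent_pair (dO : measure_display) (Omega : measurableType dO)
    (R : realType) (P : probability Omega R) (s : seq nat)
    (Z : nat -> Omega -> R[i]) (k k' : nat) :
  k \in s -> k' \in s -> k' != k -> independent P s Z ->
  forall A B : set (R * R), measurable A -> measurable B ->
  P ((fun w => reim (Z k w)) @^-1` A `&` (fun w => reim (Z k' w)) @^-1` B) =
  (P ((fun w => reim (Z k w)) @^-1` A) * P ((fun w =>
    reim (Z k' w)) @^-1` B))%E.
Proof.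
move=> ks k's kk' ind A B mA mB; pose C j := if j == k then A else B.
have uJ : uniq [:: k; k'] by rewrite /= inE eq_sym kk'.
have sJ : {subset [:: k; k'] <= s}.
  by move=> j; rewrite !inE => /orP[] /eqP ->.
have mC j : measurable (C j) by rewrite /C; case: ifP.
have := ind [:: k; k'] uJ sJ C mC.
rewrite !big_cons big_nil mule1 /C eqxx (negPf kk') /pushforward => <-.
congr (P _); apply/seteqP; split => w /=.
  by move=> [Aw Bw] j /=; rewrite !inE => /orP[] /eqP ->;
    rewrite ?eqxx ?(negPf kk').
move=> h; split.
  by have /= := h k; rewrite !inE eqxx; apply.
by have /= := h k'; rewrite !inE eqxx orbT (negPf kk'); apply.
Qed.

Theorem theorem6p4 (R : realType) (d : nat) (hd : (3 <= d)%N)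
    (sigma : probability (sphere R d.-1) R)
    (hsigma : rotation_invariant sigma)
    (V : set (sphere R d.-1 -> complex R))
    (hV : smallest_nonconstant_irreducible sigma V d)
    (v : int -> sphere R d.-1 -> complex R)
    (hv : self_conjugated_orthonormal_basis sigma V d v)
    (dO : measure_display) (Omega : measurableType dO)
    (P : probability Omega R)
    (T : sphere R d.-1 -> Omega -> R)
    (hT : invariant_random_field sigma P T)
    (hind : independent P (nonneg_indices d)
              (fun k : nat => coefficient sigma T (v k%:Z))) :
  forall k : nat, k \in nonneg_indices d ->
    complex_gaussian P (coefficient sigma T (v k%:Z)).
Proof.
case: d hd sigma hsigma V hV v hv T hT hind =>
  [//|n] n2 sigma hsigma V hV v hv T hT hind k kI.
rewrite ltnS in n2.
have VW := smallest_module_linear_forms hsigma n2 hV.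
have [vV vO _ vC] := hv; rewrite VW in vV.
have [k' k'I kk'] := other_index k (n2 : (3 <= n.+1)%N).
have vk := vV _ (nonneg_in_indices kI);
  have vk' := vV _ (nonneg_in_indices k'I).
have vNk' := vV _ (opp_in_indices k'I).
have [_ _ [a [b vab]]] := vk; have [_ _ [a' [b' vab']]] := vk'.
have vNab' : eqL2 sigma (v (- k'%:Z)) (complex_form a' (- b')).
  apply: filterS2 (vC _ (nonneg_in_indices k'I)) vab' => x -> ->.
  by rewrite /complex_form -scaleN1r linear_formZ mulN1r.
have n0 : n.+1%:R != 0 :> R by rewrite pnatr_eq0.
have dN (x y : 'cV[R]_n.+1) : dot x (- y) =
  - dot x y by rewrite -scaleN1r dotZr mulN1r.
have dNl (x y : 'cV[R]_n.+1) : dot (- x) y = - dot x y by rewrite dotC dN dotC.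
(* Orthogonality to [v k'] and to [v (- k')], its conjugate, makes the real and
   imaginary parts of the vectors of [v k] and [v k'] orthogonal. *)
have ortho : [/\ dot a a' = 0, dot a b' = 0, dot b a' = 0 & dot b b' = 0].
  have := vO _ _ (nonneg_in_indices kI) (nonneg_in_indices k'I).
  rewrite (inner_complex_form hsigma n2 vk vk' vab vab').
  have -> : (k%:Z == k'%:Z) = false by rewrite eqz_nat eq_sym (negPf kk').
  move=> /eqP; rewrite eq_complex/= !mulf_eq0 !invr_eq0 !(negPf n0) !orbF.
  move=> /andP[/eqP h1 /eqP h2].
  have := vO _ _ (nonneg_in_indices kI) (opp_in_indices k'I).
  rewrite (inner_complex_form hsigma n2 vk vNk' vab vNab').
  have -> : (k%:Z == - k'%:Z) = false.
    apply/negbTE; rewrite -subr_eq0 opprK -PoszD eqz_nat addn_eq0.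
    by apply/negP => /andP[/eqP k0 /eqP k'0]; rewrite k0 k'0 in kk'.
  move=> /eqP; rewrite eq_complex/= !mulf_eq0 !invr_eq0 !(negPf n0) !orbF !dN.
  move=> /andP[/eqP h3 /eqP h4].
  by split; lra.
have nz' : dot a' a' + dot b' b' != 0.
  have := vO _ _ (nonneg_in_indices k'I) (nonneg_in_indices k'I).
  rewrite (inner_complex_form hsigma n2 vk' vk' vab' vab') eqxx => h.
  apply/eqP => h0; move: h; rewrite h0 mul0r => /eqP.
  by rewrite eq_complex/= eq_sym oner_eq0.
apply: (gaussian_block hsigma hT (a := a) (b := - b) (a' := a') (b' := - b')
  (Z' := coefficient sigma T (v k'%:Z))).
- by move=> w; exact: (coefficient_complex_form hT w vk vab).
- by move=> w; exact: (coefficient_complex_form hT w vk' vab').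
- exact: (independent_pair kI k'I kk' hind).
- by case: ortho => h1 h2 h3 h4; rewrite !dNl !dN h1 h2 h3 h4 !oppr0.
- by rewrite !dNl !dN !opprK.
Qed.
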